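(* (Completeness.) Let $\mathcal{L}$ be a first-order language over a countable set $\mathsf{Var}$ of variables. If $A\in\mathcal{L}_{\mathrm{MT}}$ and $\vdash_{\mathrm{FO}}A^\tau$, then $\vdash_{\mathrm{D.FO}}A$ (that is, the sequent $\hat\top_F\vdash_F A$ is derivable in $\mathrm{D.FO}$, where $F$ is the type of $A$).
   Context: **First-order language.** $\mathsf{Var}=\{v_1,v_2,\dots\}$ is countable; $\mathcal{P}_\omega(\mathsf{Var})$ is the set of its finite subsets. $\mathcal{L}$ has relation symbols, function symbols (each of finite arity) and constants. Terms are as usual; formulas are $A::=R(\overline t)\mid t_1=t_2\mid\top\mid\bot\mid A\wedge A\mid A\vee A\mid A\to A\mid\forall yA\mid\exists yA$. $\mathsf{FV}$ denotes the set of free variables. For $F\in\mathcal{P}_\omega(\mathsf{Var})$, $t_F$ denotes a family $(t_v)_{v\in F}$ of terms, and $\mathsf{FV}(t_F)=\bigcup_{v\in F}\mathsf{FV}(t_v)$. If $y\notin F$, then $(s_y,t_F)$ is the family on $F\cup\{y\}$ sending $y$ to $s$ and agreeing with $t_F$ on $F$ (so in $(z_y,t_F)$ the variable $y$ is sent to the variable $z$). Sequences of distinct variables are identified with their sets of elements; $R(t_{\overline x})$ is an atomic formula whose argument list is the sequence of terms $t_{\overline x}$. $A(t_{\overline x}/\overline x)$ and $s(t_{\overline x}/\overline x)$ denote simultaneous capture-avoiding substitution, formulas of $\mathcal{L}$ being taken up to renaming of bound variables. If $\mathsf{FV}(s_T)=\overline x$, then $s(t_{\overline x}/\overline x)_T$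 is the family $(s_v(t_{\overline x}/\overline x))_{v\in T}$. **Hilbert system $\vdash_{\mathrm{FO}}$.** Axioms: propositional tautologies; $\forall x(B\to C)\to(\forall xB\to\forall xC)$; $B\to\forall xB$ with $x\notin\mathsf{FV}(B)$; $\forall xB\to B(t/x)$; $t=t$; $s=t\to(A(s/x)\to A(t/x))$; all universal closures of instances of these. Rule: modus ponens. It is sound and complete for the usual first-order models with nonempty domain (with $\exists$ understood as usual). **Multi-type formulas.** For each type $F\in\mathcal{P}_\omega(\mathsf{Var})$ the set $\mathcal{L}_F$ of formulas of type $F$ is given by simultaneous induction: $R(t_{\overline x})$ with $\mathsf{FV}(t_{\overline x})=F$; $s=t$ with $\mathsf{FV}(s)\cup\mathsf{FV}(t)=F$; $\top^F$, $\bot^F$; $A\wedge B$, $A\vee B$, $A\to B$ with $A,B\in\mathcal{L}_F$; $[y]A$ and $\langle y\rangle A$ with $y\notin F$, $A\in\mathcal{L}_{F\cup\{y\}}$; $(x)A$ with $x\in F$, $A\in\mathcal{L}_{F\setminus\{x\}}$; $(t_{F'})A$ with $A\in\mathcal{L}_{F'}$ and $\mathsf{FV}(t_{F'})=F$. $\mathcal{L}_{\mathrm{MT}}=\bigcup_F\mathcal{L}_F$. The translation $(\cdot)^\tau:\mathcal{L}_{\mathrm{MT}}\to\mathcal{L}$ is the identity on atomic formulas, sends $\top^F,\bot^F$ to $\top,\bot$, commutes with $\wedge,\vee,\to$, and $([y]A)^\tau=\forall yA^\tau$, $(\langle y\rangle A)^\tau=\exists yA^\tau$, $((x)A)^\tau=A^\tau$,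 $((t_{F'})A)^\tau=A^\tau(t_{F'}/F')$. **Structures and sequents.** Precedent structures of each type: formulas, $\hat\top_F$, $\hat R(t_{\overline x})$ (type $\mathsf{FV}(t_{\overline x})$), $s\,\hat=\,t$ (type $\mathsf{FV}(s)\cup\mathsf{FV}(t)$), $X\hat\wedge X'$, $Y\hat\succ X$, $X\hat\prec Y$, $\langle\hat x\rangle X$, $(\tilde x)X$, $(\tilde t_{F})X$, $\langle\hat t_F\rangle X$, where $X,X'$ are precedent and $Y$ succedent structures. Succedent structures: formulas, $\check\bot_F$, $Y\check\vee Y'$, $X\check\to Y$, $Y\check\leftarrow X$, $[\check x]Y$, $(\tilde x)Y$, $(\tilde t_F)Y$, $[\check t_F]Y$, where $X$ is precedent, $Y,Y'$ are succedent. Binary connectives combine structures of one and the same type. $\langle\hat x\rangle,[\check x]$ take type $F\cup\{x\}$ to $F\setminus\{x\}$; $(\tilde x)$ takes type $F\setminus\{x\}$ to $F\cup\{x\}$; $(\tilde t_F)$ takes type $F$ to $\mathsf{FV}(t_F)$; $\langle\hat t_F\rangle,[\check t_F]$ take type $\mathsf{FV}(t_F)$ to $F$. A sequent $X\vdash_F Y$ has $X$ precedent and $Y$ succedent, both of type $F$. **Rules of $\mathrm{D.FO}$** (premises / conclusion; ''//'' means the rule may be used in both directions; all sequents well-formed and well-typed). 1. Identity: $\hat R(t_{\overline x})\vdash R(t_{\overline x})$; $s\,\hat=\,t\vdash s=t$. Cut: $X\vdash_F A$ and $A\vdash_F Y$ / $X\vdash_F Y$. 2. $X\hat\wedge Y\vdash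 Z$ // $Y\vdash X\check\to Z$; $X\hat\wedge Y\vdash Z$ // $X\vdash Z\check\leftarrow Y$; $Z\vdash X\check\vee Y$ // $X\hat\succ Z\vdash Y$; $Z\vdash X\check\vee Y$ // $Z\hat\prec Y\vdash X$. 3. $X\vdash_{F\cup\{x\}}(\tilde x)Y$ // $\langle\hat x\rangle X\vdash_{F\setminus\{x\}}Y$; $(\tilde x)Y\vdash_{F\cup\{x\}}X$ // $Y\vdash_{F\setminus\{x\}}[\check x]X$. 4. With $F'=\mathsf{FV}(t_F)$: $Y\vdash_{F'}(\tilde t_F)X$ // $\langle\hat t_F\rangle Y\vdash_F X$; $(\tilde t_F)X\vdash_{F'}Y$ // $X\vdash_F[\check t_F]Y$. 5. $(\tilde x)\langle\hat x\rangle X\vdash Y$ / $X\vdash Y$; $(\tilde t_{F'})\langle\hat t_{F'}\rangle X\vdash Y$ / $X\vdash Y$. 6. $\hat\top_{F\cup\{x\}}\vdash X$ // $(\tilde x)\hat\top_{F\setminus\{x\}}\vdash X$; $X\vdash\check\bot_{F\cup\{x\}}$ // $X\vdash(\tilde x)\check\bot_{F\setminus\{x\}}$. 7. With $\mathsf{FV}(t_{F'})=F$: $\hat\top_F\vdash X$ // $(\tilde t_{F'})\hat\top_{F'}\vdash X$; $X\vdash\check\bot_F$ // $X\vdash(\tilde t_{F'})\check\bot_{F'}$. 8. $(\tilde s_{T_1})\cdots(\tilde s_{T_m})\hat R(s_{\overline x})\vdash X$ / $(\tilde t_{F_1})\cdots(\tilde t_{F_k})\hat R(t_{\overline x})\vdash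 X$, provided $((t_{F_1})\cdots(t_{F_k})R(t_{\overline x}))^\tau=((s_{T_1})\cdots(s_{T_m})R(s_{\overline x}))^\tau$; and $(\tilde s_{T_1})\cdots(\tilde s_{T_m})(r_3\,\hat=\,r_4)\vdash X$ / $(\tilde t_{F_1})\cdots(\tilde t_{F_k})(r_1\,\hat=\,r_2)\vdash X$, provided $((t_{F_1})\cdots(t_{F_k})\,r_1=r_2)^\tau=((s_{T_1})\cdots(s_{T_m})\,r_3=r_4)^\tau$. 9. $X\vdash Y$ // $\hat\top\hat\wedge X\vdash Y$; $Y\vdash X$ // $Y\vdash X\check\vee\check\bot$; exchange: $Y\hat\wedge X\vdash Z$ / $X\hat\wedge Y\vdash Z$ and $Z\vdash X\check\vee Y$ / $Z\vdash Y\check\vee X$; weakening: $Y\vdash Z$ / $X\hat\wedge Y\vdash Z$ and $Z\vdash Y$ / $Z\vdash Y\check\vee X$; contraction: $X\hat\wedge X\vdash Y$ / $X\vdash Y$ and $Y\vdash X\check\vee X$ / $Y\vdash X$; associativity: $X\hat\wedge(Y\hat\wedge Z)\vdash W$ // $(X\hat\wedge Y)\hat\wedge Z\vdash W$ and $W\vdash(Z\check\vee Y)\check\vee X$ // $W\vdash Z\check\vee(Y\check\vee X)$. 10. Equality: $(t\,\hat=\,t)\hat\wedge X\vdash Y$ / $X\vdash Y$; and $(\tilde x_1)\cdots(\tilde x_n)(t\,\hat=\,s)\vdash(\tilde y_1)\cdots(\tilde y_m)(\widetilde{t_y,r_F})X$ / $(\tilde x_1)\cdots(\tilde x_n)(t\,\hat=\,s)\vdash(\tilde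 z_1)\cdots(\tilde z_k)(\widetilde{s_y,r_F})X$, where $\{x_i\}=\mathsf{FV}(r_F)\setminus\mathsf{FV}(t,s)$, $\{y_i\}=\mathsf{FV}(s)\setminus\mathsf{FV}(t,r_F)$, $\{z_i\}=\mathsf{FV}(t)\setminus\mathsf{FV}(s,r_F)$. 11. $\hat R(s_{\overline x})\vdash X$ / $R(s_{\overline x})\vdash X$; $s\,\hat=\,t\vdash X$ / $s=t\vdash X$. 12. $\bot\vdash\check\bot$; $X\vdash\check\bot$ / $X\vdash\bot$; $\hat\top\vdash X$ / $\top\vdash X$; $\hat\top\vdash\top$; $A\hat\wedge B\vdash X$ / $A\wedge B\vdash X$; $X\vdash A$ and $Y\vdash B$ / $X\hat\wedge Y\vdash A\wedge B$; $A\vdash X$ and $B\vdash Y$ / $A\vee B\vdash X\check\vee Y$; $X\vdash A\check\vee B$ / $X\vdash A\vee B$; $X\vdash A$ and $B\vdash Y$ / $A\to B\vdash X\check\to Y$; $X\vdash A\check\to B$ / $X\vdash A\to B$. 13. Grishin: $X\hat\succ(Y\hat\wedge Z)\vdash W$ / $(X\hat\succ Y)\hat\wedge Z\vdash W$; $W\vdash X\check\to(Y\check\vee Z)$ / $W\vdash(X\check\to Y)\check\vee Z$. 14. $\langle\hat x\rangle A\vdash X$ / $\langle x\rangle A\vdash X$; $X\vdash A$ / $\langle\hat x\rangle X\vdash\langle x\rangle A$; $A\vdash X$ / $[x]A\vdash[\check x]X$; $X\vdash[\check x]A$ / $X\vdash[x]A$; $(\tilde x)A\vdash X$ / $(x)A\vdash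 X$; $X\vdash(\tilde x)A$ / $X\vdash(x)A$; $(\tilde t_{F'})A\vdash X$ / $(t_{F'})A\vdash X$; $X\vdash(\tilde t_{F'})A$ / $X\vdash(t_{F'})A$. 15. $X\vdash_{F\setminus\{x\}}Y$ // $(\tilde x)X\vdash_{F\cup\{x\}}(\tilde x)Y$; $X\vdash_{F'}Y$ / $(\tilde t_{F'})X\vdash_F(\tilde t_{F'})Y$. 16. For $\star$ either $\tilde x$ or $\tilde t_F$: $(\star)X\,\hat\circ\,(\star)Y\vdash Z$ // $(\star)(X\,\hat\circ\,Y)\vdash Z$ for $\hat\circ\in\{\hat\wedge,\hat\succ,\hat\prec\}$; $Z\vdash(\star)X\,\check\circ\,(\star)Y$ // $Z\vdash(\star)(X\,\check\circ\,Y)$ for $\check\circ\in\{\check\vee,\check\to,\check\leftarrow\}$. 17. With $x\neq y$: $(\tilde x)\langle\hat y\rangle X\vdash Y$ // $\langle\hat y\rangle(\tilde x)X\vdash Y$; $Y\vdash(\tilde x)[\check y]X$ // $Y\vdash[\check y](\tilde x)X$; $(\tilde x)(\tilde y)X\vdash Y$ // $(\tilde y)(\tilde x)X\vdash Y$; $Y\vdash(\tilde x)(\tilde y)X$ // $Y\vdash(\tilde y)(\tilde x)X$. With $z\notin\mathsf{FV}(t_{F'})\cup F'$: $(\tilde t_{F'})\langle\hat y\rangle X\vdash Y$ // $\langle\hat z\rangle(\widetilde{z_y,t_{F'}})X\vdash Y$; $Y\vdash(\tilde t_{F'})[\check y]X$ // $Y\vdash[\check z](\widetilde{z_y,t_{F'}})X$.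 With $\overline x=F=\mathsf{FV}(s_{F'})$: $(\tilde t_F)(\tilde s_{F'})X\vdash Y$ // $(\widetilde{s(t_{\overline x}/\overline x)}_{F'})X\vdash Y$; $Y\vdash(\tilde t_F)(\tilde s_{F'})X$ // $Y\vdash(\widetilde{s(t_{\overline x}/\overline x)}_{F'})X$. With $\{z_1,\dots,z_k\}=\mathsf{FV}(s)\setminus\mathsf{FV}(t_F)$: $(\widetilde{s_y,t_F})(\tilde y)X\vdash Y$ // $(\tilde z_1)\cdots(\tilde z_k)(\tilde t_F)X\vdash Y$; $Y\vdash(\widetilde{s_y,t_F})(\tilde y)X$ // $Y\vdash(\tilde z_1)\cdots(\tilde z_k)(\tilde t_F)X$. *)

(* Defs.v *)
From mathcomp Require Import all_boot.
From mathcomp Require Import finmap.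
From Stdlib Require List.

Set Implicit Arguments.
Unset Strict Implicit.
Unset Printing Implicit Defensive.

Local Open Scope fset_scope.
Local Open Scope fmap_scope.

Notation var := nat.

Definition fresh (S : {fset var}) : var := (\max_(v <- S) v).+1.

Record language := Language {
  rel_sym : Type;
  rel_ar : rel_sym -> nat;
  fun_sym : Type;
  fun_ar : fun_sym -> nat;
  const_sym : Type
}.

Inductive term (L : language) : Type :=
| Var of var
| Const of const_sym L
| Fun (f : fun_sym L) of {ffun 'I_(fun_ar f) -> term L}.

Arguments Var {L} _.
Arguments Const {L} _.

Inductive form (L : language) : Type :=
| Rel (R : rel_sym L) of {ffun 'I_(rel_ar R) -> term L}
| Eq of term L & term L
| Top
| Bot
| And of form L & form L
| Or of form L & form L
| Imp of form L & form L
| All of var & form L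
| Ex of var & form L.

Arguments Top {L}.
Arguments Bot {L}.

Section FirstOrder.
Variable L : language.
Implicit Types (s t : term L) (A B C : form L) (sg : var -> term L).

Fixpoint tfv t : {fset var} :=
  match t with
  | Var v => [fset v]
  | Const _ => fset0
  | Fun f a => \big[fsetU/fset0]_(i < fun_ar f) tfv (a i)
  end.

Definition argfv n (a : {ffun 'I_n -> term L}) : {fset var} :=
  \big[fsetU/fset0]_(i < n) tfv (a i).

Fixpoint fv A : {fset var} :=
  match A with
  | Rel _ a => argfv a
  | Eq s t => tfv s `|` tfv t
  | Top | Bot => fset0
  | And B C | Or B C | Imp B C => fv B `|` fv C
  | All y B | Ex y B => fv B `\ y
  end.

Fixpoint tsubst sg t : term L :=
  match t with
  | Var v => sg v
  | Const c => Const c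
  | Fun f a => Fun [ffun i => tsubst sg (a i)]
  end.

Definition upd sg (x : var) t : var -> term L :=
  fun v => if v == x then t else sg v.

(* The name to be given to the variable bound by a quantifier [Q y B] when
   the parallel substitution [sg] is pushed under it; [y] is kept whenever
   this captures nothing. *)
Definition bound_name sg (y : var) B : var :=
  let S := \bigcup_(v <- fv B `\ y) tfv (sg v) in
  if y \in S then fresh S else y.

Fixpoint subst sg A : form L :=
  match A with
  | Rel R a => Rel [ffun i => tsubst sg (a i)]
  | Eq s t => Eq (tsubst sg s) (tsubst sg t)
  | Top => Top
  | Bot => Bot
  | And B C => And (subst sg B) (subst sg C)
  | Or B C => Or (subst sg B) (subst sg C)
  | Imp B C => Imp (subst sg B) (subst sg C)
  | All y B => let z := bound_name sg y B in All z (subst (upd sg y (Var z)) B)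
  | Ex y B => let z := bound_name sg y B in Ex z (subst (upd sg y (Var z)) B)
  end.

Definition subst1 A t (x : var) : form L := subst (upd Var x t) A.

(* Equality up to renaming of bound variables. *)
Inductive alpha : form L -> form L -> Prop :=
| alpha_refl A : alpha A A
| alpha_sym A B : alpha A B -> alpha B A
| alpha_trans A B C : alpha A B -> alpha B C -> alpha A C
| alpha_and A A' B B' : alpha A A' -> alpha B B' -> alpha (And A B) (And A' B')
| alpha_or A A' B B' : alpha A A' -> alpha B B' -> alpha (Or A B) (Or A' B')
| alpha_imp A A' B B' : alpha A A' -> alpha B B' -> alpha (Imp A B) (Imp A' B')
| alpha_all x A A' : alpha A A' -> alpha (All x A) (All x A')
| alpha_ex x A A' : alpha A A' -> alpha (Ex x A) (Ex x A')
| alpha_all_rename x y A :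
    y \notin fv (All x A) -> alpha (All x A) (All y (subst1 A (Var y) x))
| alpha_ex_rename x y A :
    y \notin fv (Ex x A) -> alpha (Ex x A) (Ex y (subst1 A (Var y) x)).

(* Atomic and quantified formulas play the role of propositional variables. *)
Fixpoint peval (val : form L -> bool) A : bool :=
  match A with
  | Rel _ _ | Eq _ _ | All _ _ | Ex _ _ => val A
  | Top => true
  | Bot => false
  | And B C => peval val B && peval val C
  | Or B C => peval val B || peval val C
  | Imp B C => peval val B ==> peval val C
  end.

Definition tautology A : Prop := forall val, peval val A.

Definition Neg A : form L := Imp A Bot.

(* Since [Ex] is primitive, the axioms for [All] are completed by the duality
   axioms [fo_ax_ex] and [fo_ax_xe]. *)
Inductive fo_axiom : form L -> Prop :=
| fo_ax_taut A : tautology A -> fo_axiom A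
| fo_ax_K x B C :
    fo_axiom (Imp (All x (Imp B C)) (Imp (All x B) (All x C)))
| fo_ax_vac x B : x \notin fv B -> fo_axiom (Imp B (All x B))
| fo_ax_inst x B t : fo_axiom (Imp (All x B) (subst1 B t x))
| fo_ax_refl t : fo_axiom (Eq t t)
| fo_ax_leibniz x s t A :
    fo_axiom (Imp (Eq s t) (Imp (subst1 A s x) (subst1 A t x)))
| fo_ax_ex x B : fo_axiom (Imp (Ex x B) (Neg (All x (Neg B))))
| fo_ax_xe x B : fo_axiom (Imp (Neg (All x (Neg B))) (Ex x B))
| fo_ax_closure x A : fo_axiom A -> fo_axiom (All x A).

(* [fo_alpha] expresses that formulas are taken up to renaming of bound
   variables. *)
Inductive fo_provable : form L -> Prop :=
| fo_ax A : fo_axiom A -> fo_provable A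
| fo_mp A B : fo_provable (Imp A B) -> fo_provable A -> fo_provable B
| fo_alpha A B : alpha A B -> fo_provable A -> fo_provable B.

End FirstOrder.

(* A family [t_F] is a finite map with domain [F]; when [y \notin F], the
   family [(s_y, t_F)] is [t.[y <- s]]. *)
Notation family L := {fmap var -> term L}.

Section Families.
Variable L : language.

Definition famfv (t : family L) : {fset var} := \big[fsetU/fset0]_(v : domf t) tfv (t v).

Definition fam_sub (t : family L) (v : var) : term L := odflt (Var v) t.[? v].

(* [fam_comp t s] is the family s(t/x)_T, for x the domain of [t] and T that of
   [s]. *)
Definition fam_comp (t s : family L) : family L :=
  [fmap v : domf s => tsubst (fam_sub t) (s v)].

End Families.

Inductive mform (L : language) : Type :=
| MRel (R : rel_sym L) of {ffun 'I_(rel_ar R) -> term L}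
| MEq of term L & term L
| MTop of {fset var}                     (* top^F *)
| MBot of {fset var}                     (* bot^F *)
| MAnd of mform L & mform L
| MOr of mform L & mform L
| MImp of mform L & mform L
| MAll of var & mform L                  (* [y] A *)
| MEx of var & mform L                   (* <y> A *)
| MVar of var & mform L                  (* (x) A *)
| MSub of family L & mform L.            (* (t_F) A *)

Arguments MTop {L} _.
Arguments MBot {L} _.

Section MultiType.
Variable L : language.

(* [mtyped F A] means that [A] belongs to L_F. *)
Fixpoint mtyped (F : {fset var}) (A : mform L) : bool :=
  match A with
  | MRel _ a => argfv a == F
  | MEq s t => tfv s `|` tfv t == F
  | MTop G | MBot G => G == F
  | MAnd B C | MOr B C | MImp B C => mtyped F B && mtyped F C
  | MAll y B | MEx y B => (y \notin F) && mtyped (y |` F) B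
  | MVar x B => (x \in F) && mtyped (F `\ x) B
  | MSub t B => (famfv t == F) && mtyped (domf t) B
  end.

Fixpoint tau (A : mform L) : form L :=
  match A with
  | MRel R a => Rel a
  | MEq s t => Eq s t
  | MTop _ => Top
  | MBot _ => Bot
  | MAnd B C => And (tau B) (tau C)
  | MOr B C => Or (tau B) (tau C)
  | MImp B C => Imp (tau B) (tau C)
  | MAll y B => All y (tau B)
  | MEx y B => Ex y (tau B)
  | MVar _ B => tau B
  | MSub t B => subst (fam_sub t) (tau B)
  end.

End MultiType.

Inductive pre (L : language) : Type :=   (* precedent structures *)
| PForm of mform L
| PTop of {fset var}                     (* \hat\top_F *)
| PRel (R : rel_sym L) of {ffun 'I_(rel_ar R) -> term L}  (* \hat R(t) *)
| PEq of term L & term L                 (* s \hat= t *)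
| PAnd of pre L & pre L                  (* X \hat\wedge X' *)
| PSucc of suc L & pre L                 (* Y \hat\succ X *)
| PPrec of pre L & suc L                 (* X \hat\prec Y *)
| PEx of var & pre L                     (* <\hat x> X *)
| PVar of var & pre L                    (* (\tilde x) X *)
| PSub of family L & pre L               (* (\tilde t_F) X *)
| PDia of family L & pre L               (* <\hat t_F> X *)
with suc (L : language) : Type :=        (* succedent structures *)
| SForm of mform L
| SBot of {fset var}                     (* \check\bot_F *)
| SOr of suc L & suc L                   (* Y \check\vee Y' *)
| SImp of pre L & suc L                  (* X \check\to Y *)
| SCoimp of suc L & pre L                (* Y \check\leftarrow X *)
| SAll of var & suc L                    (* [\check x] Y *)
| SVar of var & suc L                    (* (\tilde x) Y *)
| SSub of family L & suc L               (* (\tilde t_F) Y *)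
| SBox of family L & suc L.              (* [\check t_F] Y *)

Arguments PTop {L} _.
Arguments SBot {L} _.

Coercion PForm : mform >-> pre.
Coercion SForm : mform >-> suc.

Record sequent (L : language) :=
  Sequent { sq_type : {fset var}; sq_pre : pre L; sq_suc : suc L }.

Notation "X |-[ F ] Y" := (@Sequent _ F X Y)
  (at level 70, F at level 200, Y at level 69, no associativity,
   format "X  |-[ F ]  Y").

Section Structures.
Variable L : language.

Fixpoint ptyped (F : {fset var}) (X : pre L) : bool :=
  match X with
  | PForm A => mtyped F A
  | PTop G => G == F
  | PRel _ a => argfv a == F
  | PEq s t => tfv s `|` tfv t == F
  | PAnd X1 X2 => ptyped F X1 && ptyped F X2
  | PSucc Y X1 => styped F Y && ptyped F X1
  | PPrec X1 Y => ptyped F X1 && styped F Y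
  | PEx x X1 => (x \notin F) && ptyped (x |` F) X1
  | PVar x X1 => (x \in F) && ptyped (F `\ x) X1
  | PSub t X1 => (famfv t == F) && ptyped (domf t) X1
  | PDia t X1 => (domf t == F) && ptyped (famfv t) X1
  end
with styped (F : {fset var}) (Y : suc L) : bool :=
  match Y with
  | SForm A => mtyped F A
  | SBot G => G == F
  | SOr Y1 Y2 => styped F Y1 && styped F Y2
  | SImp X Y1 => ptyped F X && styped F Y1
  | SCoimp Y1 X => styped F Y1 && ptyped F X
  | SAll x Y1 => (x \notin F) && styped (x |` F) Y1
  | SVar x Y1 => (x \in F) && styped (F `\ x) Y1
  | SSub t Y1 => (famfv t == F) && styped (domf t) Y1
  | SBox t Y1 => (domf t == F) && styped (famfv t) Y1
  end.

Definition well_typed (q : sequent L) : bool :=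
  ptyped (sq_type q) (sq_pre q) && styped (sq_type q) (sq_suc q).

Definition pvars (xs : seq var) (X : pre L) : pre L := foldr (@PVar L) X xs.
Definition svars (xs : seq var) (Y : suc L) : suc L := foldr (@SVar L) Y xs.
Definition psubs (ts : seq (family L)) (X : pre L) : pre L :=
  foldr (@PSub L) X ts.
Definition msubs (ts : seq (family L)) (A : mform L) : mform L :=
  foldr (@MSub L) A ts.

(* [(\tilde x)] and [(\tilde t_F)] treated uniformly. *)
Inductive star := StarVar of var | StarSub of family L.

Definition pstar (o : star) : pre L -> pre L :=
  match o with StarVar x => @PVar L x | StarSub t => @PSub L t end.
Definition sstar (o : star) : suc L -> suc L :=
  match o with StarVar x => @SVar L x | StarSub t => @SSub L t end.

Definition lists (xs : seq var) (S : {fset var}) : Prop := uniq xs /\ xs =i S.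

End Structures.

Section Calculus.
Variable L : language.
Implicit Types (F : {fset var}) (A B : mform L) (r s t : term L)
  (tF sF rF : family L) (ts ss : seq (family L)) (x y z : var)
  (xs ys zs : seq var) (o : star L).

(* Rules that may be used in both directions, given as (upper sequent, lower
   sequent). *)
Inductive birule : sequent L -> sequent L -> Prop :=
| b_and_imp F X Y Z : birule (PAnd X Y |-[F] Z) (Y |-[F] SImp X Z)
| b_and_coimp F X Y Z : birule (PAnd X Y |-[F] Z) (X |-[F] SCoimp Z Y)
| b_or_succ F X Y Z : birule (Z |-[F] SOr X Y) (PSucc X Z |-[F] Y)
| b_or_prec F X Y Z : birule (Z |-[F] SOr X Y) (PPrec Z Y |-[F] X)
| b_ex_var F x X Y :
    birule (X |-[x |` F] SVar x Y) (PEx x X |-[F `\ x] Y)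
| b_var_all F x X Y :
    birule (PVar x Y |-[x |` F] X) (Y |-[F `\ x] SAll x X)
| b_dia_sub tF X Y :
    birule (Y |-[famfv tF] SSub tF X) (PDia tF Y |-[domf tF] X)
| b_sub_box tF X Y :
    birule (PSub tF X |-[famfv tF] Y) (X |-[domf tF] SBox tF Y)
| b_top_var F x X :
    birule (PTop (x |` F) |-[x |` F] X) (PVar x (PTop (F `\ x)) |-[x |` F] X)
| b_bot_var F x X :
    birule (X |-[x |` F] SBot (x |` F)) (X |-[x |` F] SVar x (SBot (F `\ x)))
| b_top_sub tF X :
    birule (PTop (famfv tF) |-[famfv tF] X)
           (PSub tF (PTop (domf tF)) |-[famfv tF] X)
| b_bot_sub tF X :
    birule (X |-[famfv tF] SBot (famfv tF))
           (X |-[famfv tF] SSub tF (SBot (domf tF)))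
| b_top_and F X Y : birule (X |-[F] Y) (PAnd (PTop F) X |-[F] Y)
| b_or_bot F X Y : birule (Y |-[F] X) (Y |-[F] SOr X (SBot F))
| b_and_assoc F X Y Z W :
    birule (PAnd X (PAnd Y Z) |-[F] W) (PAnd (PAnd X Y) Z |-[F] W)
| b_or_assoc F X Y Z W :
    birule (W |-[F] SOr (SOr Z Y) X) (W |-[F] SOr Z (SOr Y X))
| b_var_var F x X Y :
    birule (X |-[F `\ x] Y) (PVar x X |-[x |` F] SVar x Y)
| b_star_and F o X Y Z :
    birule (PAnd (pstar o X) (pstar o Y) |-[F] Z) (pstar o (PAnd X Y) |-[F] Z)
| b_star_succ F o X Y Z :
    birule (PSucc (sstar o X) (pstar o Y) |-[F] Z) (pstar o (PSucc X Y) |-[F] Z)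
| b_star_prec F o X Y Z :
    birule (PPrec (pstar o X) (sstar o Y) |-[F] Z) (pstar o (PPrec X Y) |-[F] Z)
| b_star_or F o X Y Z :
    birule (Z |-[F] SOr (sstar o X) (sstar o Y)) (Z |-[F] sstar o (SOr X Y))
| b_star_imp F o X Y Z :
    birule (Z |-[F] SImp (pstar o X) (sstar o Y)) (Z |-[F] sstar o (SImp X Y))
| b_star_coimp F o X Y Z :
    birule (Z |-[F] SCoimp (sstar o X) (pstar o Y))
           (Z |-[F] sstar o (SCoimp X Y))
| b_var_ex F x y X Y : x != y ->
    birule (PVar x (PEx y X) |-[F] Y) (PEx y (PVar x X) |-[F] Y)
| b_var_all_comm F x y X Y : x != y ->
    birule (Y |-[F] SVar x (SAll y X)) (Y |-[F] SAll y (SVar x X))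
| b_var_swap_pre F x y X Y : x != y ->
    birule (PVar x (PVar y X) |-[F] Y) (PVar y (PVar x X) |-[F] Y)
| b_var_swap_suc F x y X Y : x != y ->
    birule (Y |-[F] SVar x (SVar y X)) (Y |-[F] SVar y (SVar x X))
| b_sub_ex F tF y z X Y :
    y \notin domf tF -> z \notin famfv tF `|` domf tF ->
    birule (PSub tF (PEx y X) |-[F] Y)
           (PEx z (PSub tF.[y <- Var z] X) |-[F] Y)
| b_sub_all F tF y z X Y :
    y \notin domf tF -> z \notin famfv tF `|` domf tF ->
    birule (Y |-[F] SSub tF (SAll y X))
           (Y |-[F] SAll z (SSub tF.[y <- Var z] X))
| b_sub_sub_pre F tF sF X Y : domf tF = famfv sF ->
    birule (PSub tF (PSub sF X) |-[F] Y) (PSub (fam_comp tF sF) X |-[F] Y)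
| b_sub_sub_suc F tF sF X Y : domf tF = famfv sF ->
    birule (Y |-[F] SSub tF (SSub sF X)) (Y |-[F] SSub (fam_comp tF sF) X)
| b_sub_var_pre F tF s y zs X Y :
    y \notin domf tF -> lists zs (tfv s `\` famfv tF) ->
    birule (PSub tF.[y <- s] (PVar y X) |-[F] Y)
           (pvars zs (PSub tF X) |-[F] Y)
| b_sub_var_suc F tF s y zs X Y :
    y \notin domf tF -> lists zs (tfv s `\` famfv tF) ->
    birule (Y |-[F] SSub tF.[y <- s] (SVar y X))
           (Y |-[F] svars zs (SSub tF X)).

(* Rules that may only be used downwards, given as (list of premises,
   conclusion). *)
Inductive rule : seq (sequent L) -> sequent L -> Prop :=
| r_id_rel F R (a : {ffun 'I_(rel_ar R) -> term L}) :
    rule [::] (PRel a |-[F] MRel a)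
| r_id_eq F s t : rule [::] (PEq s t |-[F] MEq s t)
| r_cut F X A Y : rule [:: X |-[F] A; A |-[F] Y] (X |-[F] Y)
| r_var_ex F x X Y : rule [:: PVar x (PEx x X) |-[F] Y] (X |-[F] Y)
| r_sub_dia F tF X Y : rule [:: PSub tF (PDia tF X) |-[F] Y] (X |-[F] Y)
| r_atom_rel F R (a b : {ffun 'I_(rel_ar R) -> term L}) ts ss X :
    tau (msubs ts (MRel a)) = tau (msubs ss (MRel b)) ->
    rule [:: psubs ss (PRel b) |-[F] X] (psubs ts (PRel a) |-[F] X)
| r_atom_eq F (r1 r2 r3 r4 : term L) ts ss X :
    tau (msubs ts (MEq r1 r2)) = tau (msubs ss (MEq r3 r4)) ->
    rule [:: psubs ss (PEq r3 r4) |-[F] X] (psubs ts (PEq r1 r2) |-[F] X)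
| r_and_exch F X Y Z : rule [:: PAnd Y X |-[F] Z] (PAnd X Y |-[F] Z)
| r_or_exch F X Y Z : rule [:: Z |-[F] SOr X Y] (Z |-[F] SOr Y X)
| r_and_weak F X Y Z : rule [:: Y |-[F] Z] (PAnd X Y |-[F] Z)
| r_or_weak F X Y Z : rule [:: Z |-[F] Y] (Z |-[F] SOr Y X)
| r_and_contr F X Y : rule [:: PAnd X X |-[F] Y] (X |-[F] Y)
| r_or_contr F X Y : rule [:: Y |-[F] SOr X X] (Y |-[F] X)
| r_eq_refl F t X Y : rule [:: PAnd (PEq t t) X |-[F] Y] (X |-[F] Y)
| r_eq_subst F s t rF y xs ys zs X :
    y \notin domf rF ->
    lists xs (famfv rF `\` (tfv t `|` tfv s)) ->
    lists ys (tfv s `\` (tfv t `|` famfv rF)) ->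
    lists zs (tfv t `\` (tfv s `|` famfv rF)) ->
    rule [:: pvars xs (PEq t s) |-[F] svars ys (SSub rF.[y <- t] X)]
         (pvars xs (PEq t s) |-[F] svars zs (SSub rF.[y <- s] X))
| r_rel_left F R (a : {ffun 'I_(rel_ar R) -> term L}) X :
    rule [:: PRel a |-[F] X] (MRel a |-[F] X)
| r_eq_left F s t X : rule [:: PEq s t |-[F] X] (MEq s t |-[F] X)
| r_bot_left F : rule [::] (MBot F |-[F] SBot F)
| r_bot_right F X : rule [:: X |-[F] SBot F] (X |-[F] MBot F)
| r_top_left F X : rule [:: PTop F |-[F] X] (MTop F |-[F] X)
| r_top_right F : rule [::] (PTop F |-[F] MTop F)
| r_and_left F A B X : rule [:: PAnd A B |-[F] X] (MAnd A B |-[F] X)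
| r_and_right F A B X Y :
    rule [:: X |-[F] A; Y |-[F] B] (PAnd X Y |-[F] MAnd A B)
| r_or_left F A B X Y :
    rule [:: A |-[F] X; B |-[F] Y] (MOr A B |-[F] SOr X Y)
| r_or_right F A B X : rule [:: X |-[F] SOr A B] (X |-[F] MOr A B)
| r_imp_left F A B X Y :
    rule [:: X |-[F] A; B |-[F] Y] (MImp A B |-[F] SImp X Y)
| r_imp_right F A B X : rule [:: X |-[F] SImp A B] (X |-[F] MImp A B)
| r_grishin_left F X Y Z W :
    rule [:: PSucc X (PAnd Y Z) |-[F] W] (PAnd (PSucc X Y) Z |-[F] W)
| r_grishin_right F X Y Z W :
    rule [:: W |-[F] SImp X (SOr Y Z)] (W |-[F] SOr (SImp X Y) Z)
| r_ex_left F x A X : rule [:: PEx x A |-[F] X] (MEx x A |-[F] X)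
| r_ex_right F x A X :
    rule [:: X |-[x |` F] A] (PEx x X |-[F `\ x] MEx x A)
| r_all_left F x A X :
    rule [:: A |-[x |` F] X] (MAll x A |-[F `\ x] SAll x X)
| r_all_right F x A X : rule [:: X |-[F] SAll x A] (X |-[F] MAll x A)
| r_var_left F x A X : rule [:: PVar x A |-[F] X] (MVar x A |-[F] X)
| r_var_right F x A X : rule [:: X |-[F] SVar x A] (X |-[F] MVar x A)
| r_sub_left F tF A X : rule [:: PSub tF A |-[F] X] (MSub tF A |-[F] X)
| r_sub_right F tF A X : rule [:: X |-[F] SSub tF A] (X |-[F] MSub tF A)
| r_sub_sub tF X Y :
    rule [:: X |-[domf tF] Y] (PSub tF X |-[famfv tF] SSub tF Y).

(* [birule] and [rule] give untyped schemes; asking [well_typed] of every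
   conclusion makes every sequent occurring in a derivation well typed. *)
Inductive derivable : sequent L -> Prop :=
| d_rule ps q : rule ps q -> well_typed q ->
    (forall p, List.In p ps -> derivable p) -> derivable q
| d_down p q : birule p q -> well_typed q -> derivable p -> derivable q
| d_up p q : birule p q -> well_typed p -> derivable q -> derivable p.

End Calculus.

(* Main.v *)
From mathcomp Require Import all_boot finmap.
Require Import Defs.
From Stdlib Require Import ClassicalEpsilon.

(** The obstacle is bound names. Multi-type formulas carry them literally, and the only rules that
    change one are those pushing a substitution under a quantifier, which demand a name outside both
    the domain and the variables of the family. Renaming is therefore obtained by wrapping a formula
    in the identity family, which acts trivially, and pushing that family inside with a new name.
    The same side condition is why a substituted normal form first receives an auxiliary bound name
    and is only then renamed to the prescribed one.

    Equality is the other delicate point: the calculus replaces equals only inside a substitution in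
    the succedent, with nothing but the equation in the precedent. The implication in the Leibniz
    axiom has to be packed into one substituted formula beforehand.

    Cut is used freely; it lets logical and structural connectives stand for each other, so that
    most laws can be read off the double-line rules. *)

(* To a first-order formula phi, a substitution sg and a type F containing the
   free variables of phi[sg] one associates a multi-type formula [nf F sg phi]
   of type F that expresses phi[sg] and whose bound variables are named after F
   alone.  Alpha-equivalent formulas then have the same normal form, and the
   normal form of a substituted formula is that of the original one under the
   composed substitution.  The structural rules show that the connectives (t_F)
   and (x) act on normal forms as substitution and as weakening of the type,
   so that every A of type F is interderivable with [nf F Var (tau A)].

   It remains to derive the normal forms of the Hilbert axioms.  Working at
   types that contain all variables of a given Hilbert proof makes modus ponens
   immediate; the superfluous variables are removed at the end, because
   (x)A |- (x)B implies A |- B. *)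

Set Implicit Arguments.
Unset Strict Implicit.
Unset Printing Implicit Defensive.

Local Open Scope fset_scope.
Local Open Scope fmap_scope.

Lemma fresh_notin (S : {fset var}) : fresh S \notin S.
Proof.
apply/negP => hS.
have := @leq_bigmax_seq _ (enum_fset S) xpredT id _ hS isT.
by rewrite /fresh ltnn.
Qed.

(** The typing conditions on the two sides of a rule are conjunctions of the same Boolean atoms in a
    different order; splitting on the atoms proves them equal. *)
Ltac bool_cases := repeat match goal with
  | |- context [ptyped ?F ?X] => case: (ptyped F X) => //=
  | |- context [styped ?F ?X] => case: (styped F X) => //=
  | |- context [mtyped ?F ?X] => case: (mtyped F X) => //=
  | |- context [?a == ?b] => case: (a == b) => //=
  | |- context [?x \in ?F] => case: (x \in F) => //=
  end.

Section Completeness.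
Variable L : language.
Implicit Types (F G S V : {fset var}) (A B C D : mform L) (s t u : term L)
  (p q : sequent L) (phi psi : form L) (sg rho : var -> term L)
  (tF sF : family L) (x y z : var) (xs ys zs : seq var) (o : star L)
  (X : pre L) (Y Z : suc L).

(** * Terms, families and substitution *)

(** The generated principle has no hypothesis for the arguments, because they are nested in a finite
    function. *)
Lemma term_ind_args (P : term L -> Prop) :
  (forall v, P (Var v)) -> (forall c, P (Const c)) ->
  (forall f (a : {ffun 'I_(fun_ar f) -> term L}),
     (forall i, P (a i)) -> P (Fun a)) ->
  forall t, P t.
Proof.
move=> hV hC hF; fix IH 1; case=> [v|c|f a].
- exact: hV.
- exact: hC.
- by apply: hF => i; apply: IH.
Qed.

Lemma in_argfv n (a : {ffun 'I_n -> term L}) v :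
  v \in argfv a <-> exists i, v \in tfv (a i).
Proof.
rewrite /argfv; split.
  by case/bigfcupP=> i _ hi; exists i.
by case=> i hi; apply/bigfcupP; exists i => //; rewrite mem_index_enum.
Qed.

Lemma in_tfv_tsubst sg t v :
  v \in tfv (tsubst sg t) <-> exists2 u, u \in tfv t & v \in tfv (sg u).
Proof.
elim/term_ind_args: t => [w|c|f a IH] /=.
- split=> [h|[u]]; first by exists w; rewrite ?in_fset1.
  by rewrite in_fset1 => /eqP ->.
- by split=> [|[u]]; rewrite in_fset0.
- rewrite -!/(argfv _); split.
    move/in_argfv=> [i]; rewrite ffunE => /IH [u hu hv].
    by exists u => //; apply/in_argfv; exists i.
  move=> [u /in_argfv [i hi] hv]; apply/in_argfv; exists i; rewrite ffunE.
  by apply/IH; exists u.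
Qed.

Lemma in_argfv_tsubst sg n (a : {ffun 'I_n -> term L}) v :
  v \in argfv [ffun i => tsubst sg (a i)] <->
  exists2 u, u \in argfv a & v \in tfv (sg u).
Proof.
split.
  move/in_argfv=> [i]; rewrite ffunE => /in_tfv_tsubst [u hu hv].
  by exists u => //; apply/in_argfv; exists i.
move=> [u /in_argfv [i hi] hv]; apply/in_argfv; exists i; rewrite ffunE.
by apply/in_tfv_tsubst; exists u.
Qed.

Lemma eq_tsubst sg rho t : {in tfv t, sg =1 rho} -> tsubst sg t = tsubst rho t.
Proof.
elim/term_ind_args: t => [w|c|f a IH] //= h; first by apply: h; rewrite in_fset1.
congr Fun; apply/ffunP => i; rewrite !ffunE; apply: IH => v hv.
by apply: h; rewrite -/(argfv a); apply/in_argfv; exists i.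
Qed.

Lemma tsubst_comp sg rho t :
  tsubst rho (tsubst sg t) = tsubst (tsubst rho \o sg) t.
Proof.
elim/term_ind_args: t => [w|c|f a IH] //=.
by congr Fun; apply/ffunP => i; rewrite !ffunE IH.
Qed.

Lemma tsubst_Var t : tsubst Var t = t.
Proof.
elim/term_ind_args: t => [w|c|f a IH] //=.
by congr Fun; apply/ffunP => i; rewrite !ffunE IH.
Qed.

Lemma eq_tsubst_args sg rho n (a : {ffun 'I_n -> term L}) :
  {in argfv a, sg =1 rho} ->
  [ffun i => tsubst sg (a i)] = [ffun i => tsubst rho (a i)].
Proof.
move=> h; apply/ffunP => i; rewrite !ffunE; apply: eq_tsubst => v hv.
by apply: h; apply/in_argfv; exists i.
Qed.

Lemma upd_same sg x t : upd sg x t x = t.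
Proof. by rewrite /upd eqxx. Qed.

Lemma upd_neq sg x t v : v != x -> upd sg x t v = sg v.
Proof. by rewrite /upd => /negbTE ->. Qed.

(** Absence of capture: both branches of [bound_name] return a variable outside the set of variables
    brought in for the other free variables. *)
Lemma bound_nameP sg y phi v :
  v \in fv phi -> v != y -> bound_name sg y phi \notin tfv (sg v).
Proof.
move=> hv nvy; rewrite /bound_name.
set S := \bigcup_(_ <- _) _.
have hS b : b \notin S -> b \notin tfv (sg v).
  apply: contra => hb; apply/bigfcupP; exists v => //.
  by rewrite andbT in_fsetD1 nvy.
by case: ifP => [_|/negbT]; apply: hS; rewrite ?fresh_notin.
Qed.

Lemma in_fv_subst sg phi v :
  v \in fv (subst sg phi) -> exists2 u, u \in fv phi & v \in tfv (sg u).
Proof.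
elim: phi sg v => [R a|s t|||B IHB C IHC|B IHB C IHC|B IHB C IHC|y B IH|y B IH]
  sg v //=.
- by move/in_argfv_tsubst.
- rewrite in_fsetU => /orP [] /in_tfv_tsubst [u hu hv]; exists u => //;
    by rewrite in_fsetU hu ?orbT.
- by rewrite in_fsetU => /orP [/IHB|/IHC] [u hu hv]; exists u => //;
    rewrite in_fsetU hu ?orbT.
- by rewrite in_fsetU => /orP [/IHB|/IHC] [u hu hv]; exists u => //;
    rewrite in_fsetU hu ?orbT.
- by rewrite in_fsetU => /orP [/IHB|/IHC] [u hu hv]; exists u => //;
    rewrite in_fsetU hu ?orbT.
all: rewrite in_fsetD1 => /andP [nv /IH [u hu]].
all: rewrite /upd; case: eqP => [_|/eqP nuy hv];
  first by rewrite /= in_fset1 (negbTE nv).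
all: by exists u => //; rewrite in_fsetD1 nuy.
Qed.

Lemma fam_sub_out tF v : v \notin domf tF -> fam_sub tF v = Var v.
Proof. by move=> h; rewrite /fam_sub not_fnd. Qed.

Lemma fam_subE tF (v : domf tF) : fam_sub tF (val v) = tF v.
Proof.
rewrite /fam_sub; have h := valP v; rewrite (in_fnd h) /=.
by congr (tF _); apply: val_inj.
Qed.

Lemma in_famfv tF v :
  v \in famfv tF <-> exists2 u, u \in domf tF & v \in tfv (fam_sub tF u).
Proof.
rewrite /famfv; split.
  case/bigfcupP=> i _ hi; exists (val i); first exact: valP.
  by rewrite fam_subE.
case=> u hu; rewrite -[u]/(val [` hu]) fam_subE => hv.
by apply/bigfcupP; exists [` hu] => //; rewrite mem_index_enum.
Qed.

(** [fam_sub] cannot tell a variable outside the domain from one sent to itself, hence the separate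
    hypothesis on domains. *)
Lemma fam_ext tF sF :
  domf tF = domf sF -> {in domf tF, fam_sub tF =1 fam_sub sF} -> tF = sF.
Proof.
move=> hd he; apply/fmapP => v; have := he v; rewrite /fam_sub.
case: (boolP (v \in domf tF)) => hv.
  have hv' : v \in domf sF by rewrite -hd.
  by move/(_ isT); rewrite (in_fnd hv) (in_fnd hv') /= => ->.
have hv' : v \notin domf sF by rewrite -hd.
by rewrite !not_fnd.
Qed.

Lemma fam_sub_upd tF y s v : fam_sub tF.[y <- s] v = upd (fam_sub tF) y s v.
Proof. by rewrite /fam_sub fnd_set /upd; case: eqP. Qed.

Lemma fam_sub_rem tF (S : {fset var}) v :
  v \notin S -> fam_sub tF.[\ S] v = fam_sub tF v.
Proof. by move=> hv; rewrite /fam_sub fnd_rem (negbTE hv). Qed.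

Lemma domf_rem tF (S : {fset var}) : domf tF.[\ S] = domf tF `\` S.
Proof.
apply/fsetP => v; rewrite -[v \in domf _]/(v \in tF.[\ S]) -fndSome fnd_rem.
by rewrite in_fsetD; case: (v \in S) => //=; rewrite fndSome.
Qed.

(** Brings a family into the shape (s_y, t_F) in which the rules mention it. *)
Lemma fam_rem1K tF y : y \in domf tF -> tF = tF.[~ y].[y <- fam_sub tF y].
Proof.
move=> hy; apply: fam_ext => [|v _].
  by rewrite dom_setf domf_rem fsetD1K.
rewrite fam_sub_upd; case: (eqVneq v y) => [->|nvy]; first by rewrite upd_same.
by rewrite upd_neq // fam_sub_rem // in_fset1.
Qed.

Lemma famfv_set tF y s :
  y \notin domf tF -> famfv tF.[y <- s] = tfv s `|` famfv tF.
Proof.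
move=> hy; apply/fsetP => v; rewrite in_fsetU; apply/idP/orP.
  move/in_famfv=> [u]; rewrite dom_setf fam_sub_upd in_fset1U.
  case: (eqVneq u y) => [->|nuy] /=; first by rewrite upd_same; left.
  by rewrite upd_neq // => hu hv; right; apply/in_famfv; exists u.
case=> [hv|/in_famfv [u hu hv]]; apply/in_famfv.
  exists y; first by rewrite dom_setf in_fset1U eqxx.
  by rewrite fam_sub_upd upd_same.
have nuy : u != y by apply: contraNneq hy => <-.
by exists u; rewrite ?dom_setf ?in_fset1U ?hu ?orbT // fam_sub_upd upd_neq.
Qed.

Lemma fam_sub_comp tF sF v :
  v \in domf sF -> fam_sub (fam_comp tF sF) v = tsubst (fam_sub tF) (fam_sub sF v).
Proof.
move=> hv; rewrite -[v]/(val [` hv]) (@fam_subE sF).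
by rewrite (@fam_subE (fam_comp tF sF) [` hv]) /fam_comp ffunE.
Qed.

Lemma famfv_comp tF sF :
  domf tF = famfv sF -> famfv (fam_comp tF sF) = famfv tF.
Proof.
move=> hd; apply/fsetP => v; apply/idP/idP => /in_famfv [u hu].
  rewrite fam_sub_comp // => /in_tfv_tsubst [w hw hv].
  by apply/in_famfv; exists w => //; rewrite hd; apply/in_famfv; exists u.
move=> hv; rewrite hd in hu; move/in_famfv: hu => [w hw hu].
by apply/in_famfv; exists w => //; rewrite fam_sub_comp //;
  apply/in_tfv_tsubst; exists u.
Qed.

(** Extended at one new point, this family expresses both the renaming of a variable and its
    instantiation by a term. *)
Definition fam_id F : family L := [fmap v : F => Var (val v)].

Lemma fam_sub_id F v : fam_sub (fam_id F) v = Var v.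
Proof.
case: (boolP (v \in F)) => hv; last by rewrite fam_sub_out.
by rewrite -[v]/(val [` hv]) (@fam_subE (fam_id F) [` hv]) /fam_id ffunE.
Qed.

Lemma famfv_id F : famfv (fam_id F) = F.
Proof.
apply/fsetP => v; apply/idP/idP => [/in_famfv [u hu]|hv].
  by rewrite fam_sub_id in_fset1 => /eqP ->.
by apply/in_famfv; exists v => //; rewrite fam_sub_id in_fset1.
Qed.

Lemma fam_id_set F y : (fam_id F).[y <- Var y] = fam_id (y |` F).
Proof.
apply: fam_ext => [|v _]; first by rewrite dom_setf.
rewrite fam_sub_upd /upd !fam_sub_id; by case: eqP => // ->.
Qed.

(** * Typing of the bidirectional rules *)

Lemma lists_consP x xs S :
  lists (x :: xs) S -> [/\ x \in S, x \notin S `\ x & lists xs (S `\ x)].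
Proof.
case=> /= /andP [nx ux] h; split; first by rewrite -h inE eqxx.
  by rewrite in_fsetD1 eqxx.
split=> // v; rewrite in_fsetD1 -h inE.
by case: eqVneq => //= e; apply/negbTE; rewrite e.
Qed.

(** The predicate [b] stands for the typing of precedents, succedents or formulas, so that one
    computation serves all three. *)
Lemma typed_consE x S F (b : {fset var} -> bool) : x \in S ->
  (x \in F) && ((S `\ x `<=` F `\ x) && b (F `\ x `\` (S `\ x))) =
  (S `<=` F) && b (F `\` S).
Proof.
move=> hx; rewrite andbA; congr (_ && b _); last first.
  by apply/fsetP => v; rewrite !inE; case: eqP => //= ->; rewrite hx.
apply/andP/fsubsetP => [[hF h] v hv|h].
  case: (eqVneq v x) => [->//|nvx].
  have: v \in S `\ x by rewrite in_fsetD1 nvx.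
  by move/(fsubsetP h); rewrite in_fsetD1 => /andP [].
split; first exact: h.
by apply/fsubsetP => v; rewrite !in_fsetD1 => /andP [->] /h.
Qed.

Lemma ptyped_pvars xs S F (X : pre L) : lists xs S ->
  ptyped F (pvars xs X) = (S `<=` F) && ptyped (F `\` S) X.
Proof.
elim: xs S F => [|x xs IH] S F /=.
  case=> _ h; have -> : S = fset0 by apply/fsetP => v; rewrite -h inE.
  by rewrite fsub0set fsetD0.
case/lists_consP => hx _ /IH ->.
exact: (@typed_consE x S F (fun G => ptyped G X)).
Qed.

Lemma styped_svars xs S F (X : suc L) : lists xs S ->
  styped F (svars xs X) = (S `<=` F) && styped (F `\` S) X.
Proof.
elim: xs S F => [|x xs IH] S F /=.
  case=> _ h; have -> : S = fset0 by apply/fsetP => v; rewrite -h inE.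
  by rewrite fsub0set fsetD0.
case/lists_consP => hx _ /IH ->.
exact: (@typed_consE x S F (fun G => styped G X)).
Qed.

Lemma fset1UD x F : x |` (F `\ x) = x |` F.
Proof. by apply/fsetP => v; rewrite !inE; case: eqP. Qed.

Lemma fset1UDK x F : (x |` F) `\ x = F `\ x.
Proof. by apply/fsetP => v; rewrite !inE; case: eqP. Qed.

Lemma fset1UD_neq x y F : x != y -> (y |` F) `\ x = y |` (F `\ x).
Proof.
move=> h; apply/fsetP => v; rewrite !inE.
by case: (eqVneq v x) => //= ->; rewrite (negbTE h).
Qed.

Lemma typed_swap x y F (b : {fset var} -> bool) : x != y ->
  (x \in F) && ((y \in F `\ x) && b (F `\ x `\ y)) =
  (y \in F) && ((x \in F `\ y) && b (F `\ y `\ x)).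
Proof.
move=> h; rewrite !in_fsetD1 h eq_sym h /=.
have -> : F `\ x `\ y = F `\ y `\ x.
  by apply/fsetP => v; rewrite !in_fsetD1 andbCA.
by rewrite andbCA.
Qed.

Lemma typed_exch x y F (b : {fset var} -> bool) : x != y ->
  (x \in F) && ((y \notin F `\ x) && b (y |` (F `\ x))) =
  (y \notin F) && ((x \in y |` F) && b ((y |` F) `\ x)).
Proof.
move=> h; rewrite !in_fsetD1 eq_sym h /= in_fset1U (negbTE h) /=.
by rewrite fset1UD_neq // andbCA.
Qed.

Lemma typed_sub_bind F tF y z (b : {fset var} -> bool) :
  y \notin domf tF -> z \notin famfv tF `|` domf tF ->
  (famfv tF == F) && ((y \notin domf tF) && b (y |` domf tF)) =
  (z \notin F) && ((famfv tF.[y <- Var z] == z |` F) && b (y |` domf tF)).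
Proof.
move=> hy; rewrite in_fsetU negb_or => /andP [hz _].
rewrite famfv_set // hy /= andbA; congr (_ && _).
apply/idP/idP => [/eqP <-|/andP [hF /eqP h]]; first by rewrite hz eqxx.
apply/eqP/fsetP => v; move/fsetP/(_ v): h; rewrite !inE.
by case: eqP => //= ->; rewrite (negbTE hz) (negbTE hF).
Qed.

Lemma typed_sub_var F tF s y zs (b : {fset var} -> bool) :
  y \notin domf tF ->
  (famfv tF.[y <- s] == F) &&
    ((y \in y |` domf tF) && b ((y |` domf tF) `\ y)) =
  (tfv s `\` famfv tF `<=` F) &&
    ((famfv tF == F `\` (tfv s `\` famfv tF)) && b (domf tF)).
Proof.
move=> hy; rewrite fset1U1 /= fsetU1K // famfv_set // andbA; congr (_ && _).
apply/eqP/andP => [<-|[/fsubsetP h /eqP e]].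
  split; first by apply/fsubsetP => v; rewrite !inE => /andP [_ ->].
  apply/eqP/fsetP => v; rewrite !inE.
  by case: (v \in tfv s); case: (v \in famfv tF).
apply/fsetP => v; move/fsetP/(_ v): e; move: (h v); rewrite !inE.
by case: (v \in tfv s); case: (v \in famfv tF); case: (v \in F) => //= /(_ isT).
Qed.

(** A derivation step checks only the sequent that it reaches. Since both sides of a double-line
    rule are well typed together, such a rule becomes a plain equivalence of derivability. *)
Lemma birule_typed p q : birule p q -> well_typed p = well_typed q.
Proof.
rewrite /well_typed; case => {p q} //=; try by move=> *; bool_cases.
- move=> F x X Y.
  by rewrite fset1U1 fset1UD fset1UDK in_fsetD1 eqxx; bool_cases.
- move=> F x X Y.
  by rewrite fset1U1 fset1UD fset1UDK in_fsetD1 eqxx; bool_cases.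
- by move=> *; rewrite !eqxx; bool_cases.
- by move=> *; rewrite !eqxx; bool_cases.
- by move=> *; rewrite fset1U1 fset1UDK !eqxx; bool_cases.
- by move=> *; rewrite fset1U1 fset1UDK !eqxx; bool_cases.
- by move=> *; rewrite !eqxx; bool_cases.
- by move=> *; rewrite !eqxx; bool_cases.
- by move=> *; rewrite !eqxx; bool_cases.
- by move=> *; rewrite !eqxx; bool_cases.
- by move=> *; rewrite fset1U1 fset1UDK; bool_cases.
1-6: by move=> F [x|tF] * /=; bool_cases.
- move=> F x y X Y h.
  by rewrite (@typed_exch x y F (fun G => ptyped G X)).
- move=> F x y X Y h.
  by rewrite (@typed_exch x y F (fun G => styped G X)).
- move=> F x y X Y h.
  by rewrite (@typed_swap x y F (fun G => ptyped G X)).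
- move=> F x y X Y h.
  by rewrite (@typed_swap x y F (fun G => styped G X)).
- move=> F tF y z X Y hy hz.
  by rewrite (@typed_sub_bind F tF y z (fun G => ptyped G X)).
- move=> F tF y z X Y hy hz.
  by rewrite (@typed_sub_bind F tF y z (fun G => styped G X)).
- move=> F tF sF X Y hd.
  by rewrite famfv_comp // hd eqxx.
- move=> F tF sF X Y hd.
  by rewrite famfv_comp // hd eqxx.
- move=> F tF s y zs X Y hy hzs; rewrite (ptyped_pvars _ _ hzs) /=.
  by rewrite (@typed_sub_var F tF s y zs (fun G => ptyped G X)).
- move=> F tF s y zs X Y hy hzs; rewrite (styped_svars _ _ hzs) /=.
  by rewrite (@typed_sub_var F tF s y zs (fun G => styped G X)).
Qed.

Lemma derivable_typed q : derivable q -> well_typed q.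
Proof. by case. Qed.

Lemma derivable_birule p q : birule p q -> derivable p <-> derivable q.
Proof.
move=> h; have e := birule_typed h; split=> d.
  by apply: (d_down h) => //; rewrite -e; apply: derivable_typed.
by apply: (d_up h) => //; rewrite e; apply: derivable_typed.
Qed.

(** * The preorder of derivability on formulas *)

Lemma derivable_rule0 q : rule [::] q -> well_typed q -> derivable q.
Proof. by move=> h w; apply: (d_rule h). Qed.

Lemma derivable_rule1 p q :
  rule [:: p] q -> well_typed q -> derivable p -> derivable q.
Proof. by move=> h w d; apply: (d_rule h) => // r /= [<-|[]]. Qed.

Lemma derivable_rule2 p p' q : rule [:: p; p'] q -> well_typed q ->
  derivable p -> derivable p' -> derivable q.
Proof. by move=> h w d d'; apply: (d_rule h) => // r /= [<-|[<-|[]]]. Qed.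

Lemma derivable_pre F X Y : derivable (X |-[F] Y) -> ptyped F X.
Proof. by move/derivable_typed/andP => []. Qed.

Lemma derivable_suc F X Y : derivable (X |-[F] Y) -> styped F Y.
Proof. by move/derivable_typed/andP => []. Qed.

Lemma cut F X A Y :
  derivable (X |-[F] A) -> derivable (A |-[F] Y) -> derivable (X |-[F] Y).
Proof.
move=> d d'; apply: (derivable_rule2 (r_cut _ _ _ _) _ d d').
by rewrite /well_typed /= (derivable_pre d) (derivable_suc d').
Qed.

(** * Weakening and substitution as one modality with two adjoints *)

Definition mstar o : mform L -> mform L :=
  match o with StarVar x => @MVar L x | StarSub tF => MSub tF end.
(** [pdia o] is the structural left adjoint of [o], and [sbox o] the right adjoint. *)
Definition pdia o : pre L -> pre L :=
  match o with StarVar x => @PEx L x | StarSub tF => PDia tF end.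
Definition sbox o : suc L -> suc L :=
  match o with StarVar x => @SAll L x | StarSub tF => SBox tF end.

(** [o] takes type [G] to type [F]. Naming both types, rather than computing one, lets the two kinds
    of modality share all their lemmas. *)
Definition star_typed o G F : Prop :=
  match o with
  | StarVar x => x \in F /\ G = F `\ x
  | StarSub tF => G = domf tF /\ F = famfv tF
  end.

Lemma star_typedV x F : x \notin F -> star_typed (StarVar L x) F (x |` F).
Proof. by move=> h; split; rewrite ?fset1U1 ?fsetU1K. Qed.

Lemma star_typedS tF : star_typed (StarSub tF) (domf tF) (famfv tF).
Proof. by []. Qed.

Section Star.
Variables (o : star L) (G F : {fset var}).
Hypothesis oGF : star_typed o G F.

Lemma ptyped_star X : ptyped F (pstar o X) = ptyped G X.
Proof.
by case: o oGF => [x|tF] [h e] /=; [rewrite h e | rewrite e eqxx -h].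
Qed.

Lemma styped_star Y : styped F (sstar o Y) = styped G Y.
Proof.
by case: o oGF => [x|tF] [h e] /=; [rewrite h e | rewrite e eqxx -h].
Qed.

Lemma mtyped_star A : mtyped F (mstar o A) = mtyped G A.
Proof.
by case: o oGF => [x|tF] [h e] /=; [rewrite h e | rewrite e eqxx -h].
Qed.

Lemma pdia_star X Y :
  derivable (X |-[F] sstar o Y) <-> derivable (pdia o X |-[G] Y).
Proof.
case: o oGF => [x|tF] [h e] /=.
  have := derivable_birule (b_ex_var F x X Y).
  by rewrite (mem_fset1U h) e.
by have := derivable_birule (b_dia_sub tF Y X); rewrite e h.
Qed.

Lemma star_box X Y :
  derivable (pstar o X |-[F] Y) <-> derivable (X |-[G] sbox o Y).
Proof.
case: o oGF => [x|tF] [h e] /=.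
  have := derivable_birule (b_var_all F x Y X).
  by rewrite (mem_fset1U h) e.
by have := derivable_birule (b_sub_box tF X Y); rewrite e h.
Qed.

Lemma star_star X Y :
  derivable (X |-[G] Y) -> derivable (pstar o X |-[F] sstar o Y).
Proof.
move=> d; case: o oGF => [x|tF] [h e] /=.
  have := derivable_birule (b_var_var F x X Y).
  by rewrite (mem_fset1U h) -e => <-.
rewrite e; apply: (derivable_rule1 (r_sub_sub _ _ _)); last by rewrite -h.
by rewrite /well_typed /= eqxx -h (derivable_pre d) (derivable_suc d).
Qed.

Lemma mstar_left A Y :
  derivable (pstar o A |-[F] Y) -> derivable (mstar o A |-[F] Y).
Proof.
move=> d; have w := derivable_pre d; have w' := derivable_suc d.
have: well_typed (mstar o A |-[F] Y).
  by rewrite /well_typed /= w' mtyped_star -[mtyped G A]/(ptyped G A) -ptyped_star w.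
move: d; case: (o) => [x|tF] /= d hw; apply: (derivable_rule1 _ hw d).
  exact: r_var_left.
exact: r_sub_left.
Qed.

Lemma mstar_right X A :
  derivable (X |-[F] sstar o A) -> derivable (X |-[F] mstar o A).
Proof.
move=> d; have w := derivable_pre d; have w' := derivable_suc d.
have: well_typed (X |-[F] mstar o A).
  by rewrite /well_typed /= w mtyped_star -[mtyped G A]/(styped G A) -styped_star w'.
move: d; case: (o) => [x|tF] /= d hw; apply: (derivable_rule1 _ hw d).
  exact: r_var_right.
exact: r_sub_right.
Qed.

End Star.

(** The calculus has identity axioms for atoms only; in each other case the left and right
    introduction rules of the connective fit together. *)
Lemma form_refl F A : mtyped F A -> derivable (A |-[F] A).
Proof.
elim: A F => [R a|s t|G|G|B IHB C IHC|B IHB C IHC|B IHB C IHC|y B IH|y B IH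
  |x B IH|tF B IH] F /=.
- move=> w; apply: (derivable_rule1 (r_rel_left _ _ _));
    first by rewrite /well_typed /= w.
  by apply: (derivable_rule0 (r_id_rel _ _)); rewrite /well_typed /= w.
- move=> w; apply: (derivable_rule1 (r_eq_left _ _ _ _));
    first by rewrite /well_typed /= w.
  by apply: (derivable_rule0 (r_id_eq _ _ _)); rewrite /well_typed /= w.
- move/eqP=> ->; apply: (derivable_rule1 (r_top_left _ _));
    first by rewrite /well_typed /= eqxx.
  by apply: (derivable_rule0 (r_top_right _ _)); rewrite /well_typed /= eqxx.
- move/eqP=> ->; apply: (derivable_rule1 (r_bot_right _ _));
    first by rewrite /well_typed /= eqxx.
  by apply: (derivable_rule0 (r_bot_left _ _)); rewrite /well_typed /= eqxx.
- move=> /andP [wB wC]; apply: (derivable_rule1 (r_and_left _ _ _ _)).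
    by rewrite /well_typed /= wB wC.
  apply: (derivable_rule2 (r_and_right _ _ _ _ _)) (IHB _ wB) (IHC _ wC).
  by rewrite /well_typed /= wB wC.
- move=> /andP [wB wC]; apply: (derivable_rule1 (r_or_right _ _ _ _)).
    by rewrite /well_typed /= wB wC.
  apply: (derivable_rule2 (r_or_left _ _ _ _ _)) (IHB _ wB) (IHC _ wC).
  by rewrite /well_typed /= wB wC.
- move=> /andP [wB wC]; apply: (derivable_rule1 (r_imp_right _ _ _ _)).
    by rewrite /well_typed /= wB wC.
  apply: (derivable_rule2 (r_imp_left _ _ _ _ _)) (IHB _ wB) (IHC _ wC).
  by rewrite /well_typed /= wB wC.
- move=> /andP [hy w]; apply: (derivable_rule1 (r_all_right _ _ _ _)).
    by rewrite /well_typed /= hy w.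
  have := derivable_rule1 (@r_all_left L F y B B).
  rewrite mem_fsetD1 //; apply; last exact: IH.
  by rewrite /well_typed /= hy w.
- move=> /andP [hy w]; apply: (derivable_rule1 (r_ex_left _ _ _ _)).
    by rewrite /well_typed /= hy w.
  have := derivable_rule1 (@r_ex_right L F y B B).
  rewrite mem_fsetD1 //; apply; last exact: IH.
  by rewrite /well_typed /= hy w.
- move=> /andP [hx w]; have h : star_typed (StarVar L x) (F `\ x) F by [].
  apply: (mstar_left h); apply: (mstar_right h); apply: (star_star h).
  exact: IH.
- move=> /andP [/eqP e w]; have h : star_typed (StarSub tF) (domf tF) F by [].
  apply: (mstar_left h); apply: (mstar_right h); apply: (star_star h).
  exact: IH.
Qed.

Definition le F A B : Prop := derivable (A |-[F] B).

Lemma le_typedl F A B : le F A B -> mtyped F A.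
Proof. exact: derivable_pre. Qed.

Lemma le_typedr F A B : le F A B -> mtyped F B.
Proof. exact: derivable_suc. Qed.

Lemma le_trans F A B C : le F A B -> le F B C -> le F A C.
Proof. exact: cut. Qed.

Definition eqv F A B : Prop := le F A B /\ le F B A.

Lemma eqv_refl F A : mtyped F A -> eqv F A A.
Proof. by move=> w; split; apply: form_refl. Qed.

Lemma eqv_sym F A B : eqv F A B -> eqv F B A.
Proof. by case. Qed.

Lemma eqv_trans F A B C : eqv F A B -> eqv F B C -> eqv F A C.
Proof. by move=> [h1 h2] [h3 h4]; split; apply: le_trans; eassumption. Qed.

Lemma le_top F A : mtyped F A -> le F A (MTop F).
Proof.
move=> w; apply/(derivable_birule (b_top_and _ _ _)).
apply: (derivable_rule1 (r_and_exch _ _ _ _));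
    first by rewrite /well_typed /= w !eqxx.
apply: (derivable_rule1 (r_and_weak _ _ _ _));
    first by rewrite /well_typed /= w !eqxx.
by apply: (derivable_rule0 (r_top_right _ _)); rewrite /well_typed /= eqxx.
Qed.

Lemma le_bot F A : mtyped F A -> le F (MBot F) A.
Proof.
move=> w; apply/(derivable_birule (b_or_bot _ _ _)).
apply: (derivable_rule1 (r_or_exch _ _ _ _));
    first by rewrite /well_typed /= w !eqxx.
apply: (derivable_rule1 (r_or_weak _ _ _ _));
    first by rewrite /well_typed /= w !eqxx.
by apply: (derivable_rule0 (r_bot_left _ _)); rewrite /well_typed /= eqxx.
Qed.

(** As for the connectives below, one direction is an introduction rule and the other, its
    invertibility, is a cut against the opposite introduction rule. *)
Lemma derivable_top F Y : derivable (PTop F |-[F] Y) <-> derivable (MTop F |-[F] Y).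
Proof.
split=> d.
  apply: (derivable_rule1 (r_top_left _ _) _ d).
  by rewrite /well_typed /= (derivable_suc d) eqxx.
apply: (fun e => cut e d); apply: (derivable_rule0 (r_top_right _ _)).
by rewrite /well_typed /= eqxx.
Qed.

Lemma derivable_bot F X : derivable (X |-[F] SBot F) <-> derivable (X |-[F] MBot F).
Proof.
split=> d.
  apply: (derivable_rule1 (r_bot_right _ _) _ d).
  by rewrite /well_typed /= (derivable_pre d) eqxx.
apply: (cut d); apply: (derivable_rule0 (r_bot_left _ _)).
by rewrite /well_typed /= eqxx.
Qed.

Lemma derivable_and F A B Y :
  derivable (PAnd A B |-[F] Y) <-> derivable (MAnd A B |-[F] Y).
Proof.
split=> d; have w' := derivable_suc d; have /= /andP [wA wB] := derivable_pre d.
  by apply: (derivable_rule1 (r_and_left _ _ _ _) _ d); rewrite /well_typed /= wA wB.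
apply: (fun e => cut e d); apply: (derivable_rule2 (r_and_right _ _ _ _ _));
  [|exact: form_refl|exact: form_refl]; by rewrite /well_typed /= wA wB.
Qed.

Lemma derivable_or F A B X :
  derivable (X |-[F] SOr A B) <-> derivable (X |-[F] MOr A B).
Proof.
split=> d; have w := derivable_pre d; have /= /andP [wA wB] := derivable_suc d.
  by apply: (derivable_rule1 (r_or_right _ _ _ _) _ d); rewrite /well_typed /= wA wB w.
apply: (cut d); apply: (derivable_rule2 (r_or_left _ _ _ _ _));
  [|exact: form_refl|exact: form_refl]; by rewrite /well_typed /= wA wB.
Qed.

Lemma derivable_imp F A B X :
  derivable (X |-[F] SImp A B) <-> derivable (X |-[F] MImp A B).
Proof.
split=> d; have w := derivable_pre d; have /= /andP [wA wB] := derivable_suc d.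
  by apply: (derivable_rule1 (r_imp_right _ _ _ _) _ d); rewrite /well_typed /= wA wB w.
apply: (cut d); apply: (derivable_rule2 (r_imp_left _ _ _ _ _));
  [|exact: form_refl|exact: form_refl]; by rewrite /well_typed /= wA wB.
Qed.

Lemma le_andr F A B : mtyped F A -> mtyped F B -> le F (MAnd A B) B.
Proof.
move=> wA wB; apply/derivable_and; apply: (derivable_rule1 (r_and_weak _ _ _ _)).
  by rewrite /well_typed /= wA wB.
exact: form_refl.
Qed.

Lemma le_andl F A B : mtyped F A -> mtyped F B -> le F (MAnd A B) A.
Proof.
move=> wA wB; apply/derivable_and; apply: (derivable_rule1 (r_and_exch _ _ _ _)).
  by rewrite /well_typed /= wA wB.
by apply/derivable_and; apply: le_andr.
Qed.

Lemma le_and F A B C : le F C A -> le F C B -> le F C (MAnd A B).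
Proof.
move=> hA hB; have wA := le_typedr hA; have wB := le_typedr hB.
have wC := le_typedl hA; apply: (derivable_rule1 (r_and_contr _ _ _)).
  by rewrite /well_typed /= wA wB wC.
apply: (derivable_rule2 (r_and_right _ _ _ _ _)) hA hB.
by rewrite /well_typed /= wA wB wC.
Qed.

Lemma le_orl F A B : mtyped F A -> mtyped F B -> le F A (MOr A B).
Proof.
move=> wA wB; apply/derivable_or; apply: (derivable_rule1 (r_or_weak _ _ _ _)).
  by rewrite /well_typed /= wA wB.
exact: form_refl.
Qed.

Lemma le_orr F A B : mtyped F A -> mtyped F B -> le F B (MOr A B).
Proof.
move=> wA wB; apply/derivable_or; apply: (derivable_rule1 (r_or_exch _ _ _ _)).
  by rewrite /well_typed /= wA wB.
by apply/derivable_or; apply: le_orl.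
Qed.

Lemma le_or F A B C : le F A C -> le F B C -> le F (MOr A B) C.
Proof.
move=> hA hB; have wA := le_typedl hA; have wB := le_typedl hB.
have wC := le_typedr hA; apply: (derivable_rule1 (r_or_contr _ _ _)).
  by rewrite /well_typed /= wA wB wC.
apply: (derivable_rule2 (r_or_left _ _ _ _ _)) hA hB.
by rewrite /well_typed /= wA wB wC.
Qed.

Lemma le_imp F A B C : le F (MAnd A B) C <-> le F B (MImp A C).
Proof.
rewrite /le -derivable_and -derivable_imp.
exact: derivable_birule (b_and_imp _ _ _ _).
Qed.

Definition mneg F A : mform L := MImp A (MBot F).

(** Classical logic comes from the Grishin rule. The residuation steps before it only turn the
    negation under the disjunction into a structural implication. *)
Lemma le_em F A : mtyped F A -> le F (MTop F) (MOr (mneg F A) A).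
Proof.
move=> w; apply/derivable_or/(derivable_birule (b_or_prec _ _ _ _)).
apply/derivable_imp/(derivable_birule (b_and_imp _ _ _ _))/derivable_bot.
apply/(derivable_birule (b_and_imp _ _ _ _))/(derivable_birule (b_or_prec _ _ _ _)).
(* The disjunct [A] enters the scope of the implication, where it can be met by the antecedent
   [A]. *)
apply: (derivable_rule1 (r_grishin_right _ _ _ _ _)).
  by rewrite /well_typed /= w !eqxx.
apply/(derivable_birule (b_and_imp _ _ _ _)).
apply: (derivable_rule1 (r_or_exch _ _ _ _));
    first by rewrite /well_typed /= w !eqxx.
apply: (derivable_rule1 (r_or_weak _ _ _ _));
    first by rewrite /well_typed /= w !eqxx.
by apply/derivable_and/le_andl => //=.
Qed.

Lemma le_mp F A B C : le F C (MImp A B) -> le F C A -> le F C B.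
Proof.
move=> /le_imp h hA; apply: le_trans h; apply: (le_and hA).
exact: form_refl (le_typedl hA).
Qed.

Lemma le_imp_swap F A B C : le F A (MImp B C) -> le F B (MImp A C).
Proof.
move=> h; have /= /andP [wB _] := le_typedr h; have wA := le_typedl h.
apply/le_imp; apply: (@le_mp _ B); last exact: le_andr.
by apply: le_trans h; apply: le_andl.
Qed.

Lemma le_case F A B C : mtyped F B ->
  le F (MAnd B A) C -> le F (MAnd (mneg F B) A) C -> le F A C.
Proof.
move=> wB /le_imp h1 /le_imp h2; have wA := le_typedl h1.
apply: (@le_mp _ A); last exact: form_refl.
apply: le_trans (le_top wA) (le_trans (le_em wB) _).
by apply: le_or; apply: le_imp_swap.
Qed.

Lemma le_imp2 F A A' B B' : le F A' A -> le F B B' ->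
  le F (MImp A B) (MImp A' B').
Proof.
move=> hA hB; have wA := le_typedr hA; have wA' := le_typedl hA.
have wB := le_typedl hB.
have wI : mtyped F (MImp A B) by rewrite /= wA wB.
apply/le_imp; apply: le_trans hB; apply: (@le_mp _ A).
  exact: le_andr.
by apply: le_trans hA; apply: le_andl.
Qed.

Lemma eqv_and F A A' B B' : eqv F A A' -> eqv F B B' ->
  eqv F (MAnd A B) (MAnd A' B').
Proof.
move=> [hA hA'] [hB hB']; have wA := le_typedr hA; have wA' := le_typedl hA.
have wB := le_typedl hB; have wB' := le_typedr hB.
split; apply: le_and.
- by apply: le_trans hA; apply: le_andl.
- by apply: le_trans hB; apply: le_andr.
- by apply: le_trans hA'; apply: le_andl.
- by apply: le_trans hB'; apply: le_andr.
Qed.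

Lemma eqv_or F A A' B B' : eqv F A A' -> eqv F B B' ->
  eqv F (MOr A B) (MOr A' B').
Proof.
move=> [hA hA'] [hB hB']; have wA := le_typedr hA; have wA' := le_typedl hA.
have wB := le_typedl hB; have wB' := le_typedr hB.
split; apply: le_or.
- by apply: (le_trans hA); apply: le_orl.
- by apply: (le_trans hB); apply: le_orr.
- by apply: (le_trans hA'); apply: le_orl.
- by apply: (le_trans hB'); apply: le_orr.
Qed.

Lemma eqv_imp F A A' B B' : eqv F A A' -> eqv F B B' ->
  eqv F (MImp A B) (MImp A' B').
Proof. by move=> [hA hA'] [hB hB']; split; apply: le_imp2. Qed.

(* By cut, two formulas are equivalent as soon as they have the same
   derivable sequents on one side, so equivalences can be read off the
   bidirectional structural rules. *)
Definition suc_eqv F Y Z : Prop :=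
  forall X, derivable (X |-[F] Y) <-> derivable (X |-[F] Z).

Definition pre_eqv F X X' : Prop :=
  forall Y, derivable (X |-[F] Y) <-> derivable (X' |-[F] Y).

Lemma suc_eqv_sym F Y Z : suc_eqv F Y Z -> suc_eqv F Z Y.
Proof. by move=> h X; rewrite h. Qed.

Lemma suc_eqv_trans F Y Y' Z : suc_eqv F Y Y' -> suc_eqv F Y' Z -> suc_eqv F Y Z.
Proof. by move=> h h' X; rewrite h h'. Qed.

Lemma pre_eqv_sym F X X' : pre_eqv F X X' -> pre_eqv F X' X.
Proof. by move=> h Y; rewrite h. Qed.

Lemma pre_eqv_trans F X X1 X' : pre_eqv F X X1 -> pre_eqv F X1 X' -> pre_eqv F X X'.
Proof. by move=> h h' Y; rewrite h h'. Qed.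

Lemma suc_eqv_le F A B : mtyped F A -> suc_eqv F A B -> eqv F A B.
Proof.
move=> w h; have d : le F A B by apply/h; apply: form_refl.
by split=> //; apply/h/form_refl/(le_typedr d).
Qed.

Lemma pre_eqv_le F A B : mtyped F A -> pre_eqv F A B -> eqv F A B.
Proof.
move=> w h; have d : le F B A by apply/h; apply: form_refl.
by split=> //; apply/h/form_refl/(le_typedl d).
Qed.

(** Cut applies to formulas only, so for structures the congruence is obtained by moving [o] to the
    other side through its adjoint. *)
Lemma suc_eqv_star o G F Y Z : star_typed o G F ->
  suc_eqv G Y Z -> suc_eqv F (sstar o Y) (sstar o Z).
Proof. by move=> h e X; rewrite !(pdia_star h). Qed.

Lemma pre_eqv_star o G F X X' : star_typed o G F ->
  pre_eqv G X X' -> pre_eqv F (pstar o X) (pstar o X').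
Proof. by move=> h e Y; rewrite !(star_box h). Qed.

Lemma suc_eqv_mstar o G F A : star_typed o G F ->
  suc_eqv F (sstar o A) (mstar o A).
Proof.
move=> h X; split; first exact: (mstar_right h).
move=> d; apply: (cut d); apply: (mstar_left h); apply: (star_star h).
by apply: form_refl; rewrite -(mtyped_star h); apply: (derivable_suc d).
Qed.

Lemma pre_eqv_mstar o G F A : star_typed o G F ->
  pre_eqv F (pstar o A) (mstar o A).
Proof.
move=> h Y; split; first exact: (mstar_left h).
move=> d; apply: (fun e => cut e d); apply: (mstar_right h); apply: (star_star h).
by apply: form_refl; rewrite -(mtyped_star h); apply: (derivable_pre d).
Qed.

Lemma suc_eqv_all y F Y Z : y \notin F ->
  suc_eqv (y |` F) Y Z -> suc_eqv F (SAll y Y) (SAll y Z).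
Proof.
move=> hy e X.
have h W := derivable_birule (b_var_all F y W X).
by rewrite (mem_fsetD1 hy) in h; rewrite -!h.
Qed.

Lemma pre_eqv_ex y F X X' : y \notin F ->
  pre_eqv (y |` F) X X' -> pre_eqv F (PEx y X) (PEx y X').
Proof.
move=> hy e Y.
have h W := derivable_birule (b_ex_var F y W Y).
by rewrite (mem_fsetD1 hy) in h; rewrite -!h.
Qed.

Lemma suc_eqv_mall y F A : y \notin F -> suc_eqv F (SAll y A) (MAll y A).
Proof.
move=> hy X; split=> d; have w := derivable_pre d; have /= wA := derivable_suc d.
  by apply: (derivable_rule1 (r_all_right _ _ _ _) _ d); rewrite /well_typed /= w wA.
apply: (cut d); have := derivable_rule1 (@r_all_left L F y A A).
case/andP: wA => _ wA.
rewrite mem_fsetD1 //; apply; last exact: form_refl.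
by rewrite /well_typed /= hy wA.
Qed.

Lemma pre_eqv_mex y F A : y \notin F -> pre_eqv F (PEx y A) (MEx y A).
Proof.
move=> hy X; split=> d; have w := derivable_suc d; have /= wA := derivable_pre d.
  by apply: (derivable_rule1 (r_ex_left _ _ _ _) _ d); rewrite /well_typed /= w wA.
apply: (fun e => cut e d); have := derivable_rule1 (@r_ex_right L F y A A).
case/andP: wA => _ wA.
rewrite mem_fsetD1 //; apply; last exact: form_refl.
by rewrite /well_typed /= hy wA.
Qed.

(** Weakening by [y] has the universal quantifier as right adjoint and, in [ex_adj], the existential
    one as left adjoint. The quantifier axioms are later proved from these adjunctions. *)
Lemma all_adj y F A B : y \notin F ->
  le (y |` F) (MVar y A) B <-> le F A (MAll y B).
Proof.
move=> hy; have h := star_typedV hy.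
rewrite /le -(suc_eqv_mall B hy A) -(pre_eqv_mstar A h) (star_box h).
by [].
Qed.

Lemma ex_adj y F A B : y \notin F ->
  le (y |` F) A (MVar y B) <-> le F (MEx y A) B.
Proof.
move=> hy; have h := star_typedV hy.
by rewrite /le -(pre_eqv_mex A hy B) -(suc_eqv_mstar B h) (pdia_star h).
Qed.

Lemma le_star o G F A B : star_typed o G F -> le G A B ->
  le F (mstar o A) (mstar o B).
Proof.
move=> h d; apply: (mstar_left h); apply: (mstar_right h); exact: (star_star h).
Qed.

Lemma eqv_star o G F A B : star_typed o G F -> eqv G A B ->
  eqv F (mstar o A) (mstar o B).
Proof. by move=> h [d d']; split; apply: (le_star h). Qed.

(** The upward reading of [b_var_var]. Semantically, an inclusion between cylinders over [x] passes
    to their bases because [x] has some value to take. *)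
Lemma le_var_reflect x F A B : x \notin F ->
  le (x |` F) (MVar x A) (MVar x B) -> le F A B.
Proof.
move=> hx; have h := star_typedV hx.
rewrite /le -(suc_eqv_mstar B h) -(pre_eqv_mstar A h) /=.
have := derivable_birule (b_var_var F x A B).
by rewrite (mem_fsetD1 hx) => ->.
Qed.

(** * Commutation of weakening and substitution with the logical connectives *)

(** One half is monotonicity. For the other, [b_star_and] needs structural modalities on both
    conjuncts, so residuation isolates each conjunct in turn and replaces its outermost
    connective. *)
Lemma mstar_and o G F A B : star_typed o G F -> mtyped G A -> mtyped G B ->
  eqv F (mstar o (MAnd A B)) (MAnd (mstar o A) (mstar o B)).
Proof.
move=> h wA wB; split.
  by apply: le_and; apply: (le_star h); [apply: le_andl | apply: le_andr].
apply/derivable_and.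
apply/(derivable_birule (b_and_imp _ _ _ _))/(pre_eqv_mstar B h).
apply/(derivable_birule (b_and_imp _ _ _ _))/(derivable_birule (b_and_coimp _ _ _ _)).
apply/(pre_eqv_mstar A h)/(derivable_birule (b_and_coimp _ _ _ _)).
apply/(derivable_birule (b_star_and _ _ _ _ _)); apply: (mstar_right h).
by apply: (star_star h); apply/derivable_and/form_refl; rewrite /= wA wB.
Qed.

Lemma mstar_or o G F A B : star_typed o G F -> mtyped G A -> mtyped G B ->
  eqv F (mstar o (MOr A B)) (MOr (mstar o A) (mstar o B)).
Proof.
move=> h wA wB; split; last first.
  by apply: le_or; apply: (le_star h); [apply: le_orl | apply: le_orr].
apply/derivable_or.
apply/(derivable_birule (b_or_succ _ _ _ _))/(suc_eqv_mstar B h).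
apply/(derivable_birule (b_or_succ _ _ _ _))/(derivable_birule (b_or_prec _ _ _ _)).
apply/(suc_eqv_mstar A h)/(derivable_birule (b_or_prec _ _ _ _)).
apply/(derivable_birule (b_star_or _ _ _ _ _)); apply: (mstar_left h).
by apply: (star_star h); apply/derivable_or/form_refl; rewrite /= wA wB.
Qed.

Lemma mstar_imp o G F A B : star_typed o G F -> mtyped G A -> mtyped G B ->
  eqv F (mstar o (MImp A B)) (MImp (mstar o A) (mstar o B)).
Proof.
move=> h wA wB; have wI : mtyped G (MImp A B) by rewrite /= wA wB.
split.
  apply/le_imp; apply: le_trans (_ : le F _ (mstar o (MAnd A (MImp A B)))) _.
    by case: (mstar_and h wA wI).
  by apply: (le_star h); apply/le_imp/form_refl.
(* The adjoint strips [o] for a moment, so that the implication beneath it can be made structural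
   for [b_star_imp]. *)
apply: (mstar_right h); apply/(pdia_star h)/derivable_imp/(pdia_star h).
apply/(derivable_birule (b_star_imp _ _ _ _ _)).
apply: (derivable_rule2 (r_imp_left _ _ _ _ _)).
- rewrite /well_typed /= !(mtyped_star h) wA wB (ptyped_star h) (styped_star h) /=.
  by rewrite wA.
- by apply/(pre_eqv_mstar A h)/form_refl; rewrite (mtyped_star h).
- by apply/(suc_eqv_mstar B h)/form_refl; rewrite (mtyped_star h).
Qed.

Lemma mstar_top o G F : star_typed o G F -> eqv F (mstar o (MTop G)) (MTop F).
Proof.
move=> h; split; first by apply: le_top; rewrite (mtyped_star h) /=.
have e : pre_eqv F (PTop F) (pstar o (PTop G)).
  move=> Y; case: o h => [x|tF] [hx hG] /=.
    have := derivable_birule (b_top_var F x Y).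
    by rewrite (mem_fset1U hx) hG.
  have := derivable_birule (b_top_sub tF Y).
  by rewrite hx hG.
apply/derivable_top/e; apply: (mstar_right h); apply: (star_star h).
by apply/derivable_top/form_refl => /=.
Qed.

Lemma mstar_bot o G F : star_typed o G F -> eqv F (mstar o (MBot G)) (MBot F).
Proof.
move=> h; split; last by apply: le_bot; rewrite (mtyped_star h) /=.
have e : suc_eqv F (SBot F) (sstar o (SBot G)).
  move=> Y; case: o h => [x|tF] [hx hG] /=.
    have := derivable_birule (b_bot_var F x Y).
    by rewrite (mem_fset1U hx) hG.
  have := derivable_birule (b_bot_sub tF Y).
  by rewrite hx hG.
apply/derivable_bot/e; apply: (mstar_left h); apply: (star_star h).
by apply/derivable_bot/form_refl => /=.
Qed.

Definition mquant (b : bool) : var -> mform L -> mform L :=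
  if b then @MAll L else @MEx L.

Lemma mtyped_quant b y F A : y \notin F ->
  mtyped F (mquant b y A) = mtyped (y |` F) A.
Proof. by case: b => /= ->. Qed.

Lemma eqv_quant b y F A B : y \notin F -> eqv (y |` F) A B ->
  eqv F (mquant b y A) (mquant b y B).
Proof.
move=> hy; have h := star_typedV hy.
have mon C D : le (y |` F) C D -> le F (mquant b y C) (mquant b y D).
  move=> d; case: b => /=.
    apply/all_adj => //; apply: (fun e => le_trans e d); apply/all_adj => //.
    by apply: form_refl; rewrite /= hy (le_typedl d).
  apply/ex_adj => //; apply: (le_trans d); apply/ex_adj => //.
  by apply: form_refl; rewrite /= hy (le_typedr d).
by case=> d d'; split; apply: mon.
Qed.

(** The structural universal quantifier exists only in succedents and the existential one only in
    precedents. Hence the two cases compare sequents on opposite sides. *)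
Lemma mvar_quant b x y F A : x \in F -> y \notin F ->
  mtyped (y |` (F `\ x)) A ->
  eqv F (MVar x (mquant b y A)) (mquant b y (MVar x A)).
Proof.
move=> hx hy wA; have nxy : x != y by apply: contraNneq hy => <-.
have hyx : y \notin F `\ x by rewrite in_fsetD1 negb_and hy orbT.
have h : star_typed (StarVar L x) (F `\ x) F by [].
have h' : star_typed (StarVar L x) (y |` (F `\ x)) (y |` F).
  by split; rewrite ?fset1UD_neq // in_fset1U hx orbT.
have w : mtyped F (MVar x (mquant b y A)) by rewrite /= hx mtyped_quant.
case: b w => w.
  apply: suc_eqv_le => //.
  apply: suc_eqv_trans (suc_eqv_sym (suc_eqv_mstar _ h)) _.
  apply: suc_eqv_trans (suc_eqv_star h (suc_eqv_sym (suc_eqv_mall _ hyx))) _.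
  apply: suc_eqv_trans (suc_eqv_mall _ hy).
  apply: suc_eqv_trans (suc_eqv_all hy (suc_eqv_mstar _ h')).
  by move=> X; apply: derivable_birule; constructor.
apply: pre_eqv_le => //.
apply: pre_eqv_trans (pre_eqv_sym (pre_eqv_mstar _ h)) _.
apply: pre_eqv_trans (pre_eqv_star h (pre_eqv_sym (pre_eqv_mex _ hyx))) _.
apply: pre_eqv_trans (pre_eqv_mex _ hy).
apply: pre_eqv_trans (pre_eqv_ex hy (pre_eqv_mstar _ h')).
by move=> X; apply: derivable_birule; constructor.
Qed.

(** The source of all renaming of bound variables: the bound [y] may occur in the terms of [tF], so
    the quantifier takes a new name [z]. *)
Lemma msub_quant b tF y z A :
  y \notin domf tF -> z \notin famfv tF `|` domf tF -> mtyped (y |` domf tF) A ->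
  eqv (famfv tF) (MSub tF (mquant b y A)) (mquant b z (MSub tF.[y <- Var z] A)).
Proof.
move=> hy hz wA; have h := star_typedS tF.
have hz' : z \notin famfv tF by move: hz; rewrite in_fsetU negb_or => /andP [].
have h' : star_typed (StarSub tF.[y <- Var z]) (y |` domf tF) (z |` famfv tF).
  by split; rewrite ?dom_setf // famfv_set.
have w : mtyped (famfv tF) (MSub tF (mquant b y A)).
  by rewrite /= eqxx mtyped_quant.
case: b w => w.
  apply: suc_eqv_le => //.
  apply: suc_eqv_trans (suc_eqv_sym (suc_eqv_mstar _ h)) _.
  apply: suc_eqv_trans (suc_eqv_star h (suc_eqv_sym (suc_eqv_mall _ hy))) _.
  apply: suc_eqv_trans (suc_eqv_mall _ hz').
  apply: suc_eqv_trans (suc_eqv_all hz' (suc_eqv_mstar _ h')).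
  by move=> X; apply: derivable_birule; constructor.
apply: pre_eqv_le => //.
apply: pre_eqv_trans (pre_eqv_sym (pre_eqv_mstar _ h)) _.
apply: pre_eqv_trans (pre_eqv_star h (pre_eqv_sym (pre_eqv_mex _ hy))) _.
apply: pre_eqv_trans (pre_eqv_mex _ hz').
apply: pre_eqv_trans (pre_eqv_ex hz' (pre_eqv_mstar _ h')).
by move=> X; apply: derivable_birule; constructor.
Qed.

Lemma mvar_swap x y F A : x \in F -> y \in F -> x != y ->
  mtyped (F `\ x `\ y) A -> eqv F (MVar x (MVar y A)) (MVar y (MVar x A)).
Proof.
move=> hx hy nxy wA.
have e : F `\ x `\ y = F `\ y `\ x.
  by apply/fsetP => v; rewrite !in_fsetD1 andbCA.
have hx1 : star_typed (StarVar L x) (F `\ x) F by [].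
have hy1 : star_typed (StarVar L y) (F `\ y) F by [].
have hx2 : star_typed (StarVar L x) (F `\ y `\ x) (F `\ y).
  by split=> //; rewrite in_fsetD1 nxy.
have hy2 : star_typed (StarVar L y) (F `\ x `\ y) (F `\ x).
  by split=> //; rewrite in_fsetD1 eq_sym nxy.
apply: suc_eqv_le.
  by rewrite (mtyped_star hx1 (MVar y A)) (mtyped_star hy2 A).
apply: suc_eqv_trans (suc_eqv_sym (suc_eqv_mstar _ hx1)) _.
apply: suc_eqv_trans (suc_eqv_star hx1 (suc_eqv_sym (suc_eqv_mstar _ hy2))) _.
apply: suc_eqv_trans (suc_eqv_mstar _ hy1).
apply: suc_eqv_trans (suc_eqv_star hy1 (suc_eqv_mstar _ hx2)).
by move=> X; apply: derivable_birule; constructor.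
Qed.

Lemma msub_comp tF sF A : domf tF = famfv sF -> mtyped (domf sF) A ->
  eqv (famfv tF) (MSub tF (MSub sF A)) (MSub (fam_comp tF sF) A).
Proof.
move=> hd wA; have ht : star_typed (StarSub tF) (famfv sF) (famfv tF) by [].
have hs := star_typedS sF.
have hts : star_typed (StarSub (fam_comp tF sF)) (domf sF) (famfv tF).
  by split; rewrite ?famfv_comp.
apply: suc_eqv_le.
  by rewrite (mtyped_star ht (MSub sF A)) (mtyped_star hs A).
apply: suc_eqv_trans (suc_eqv_sym (suc_eqv_mstar _ ht)) _.
apply: suc_eqv_trans (suc_eqv_star ht (suc_eqv_sym (suc_eqv_mstar _ hs))) _.
apply: suc_eqv_trans (suc_eqv_mstar _ hts).
by move=> X; apply: derivable_birule; constructor.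
Qed.

Definition mvars xs A : mform L := foldr (@MVar L) A xs.

Lemma suc_eqv_mvars xs S F A : lists xs S -> S `<=` F ->
  suc_eqv F (svars xs A) (mvars xs A).
Proof.
elim: xs S F => [|x xs IH] S F //= /lists_consP [hx _ hl] hS.
have h : star_typed (StarVar L x) (F `\ x) F.
  by split=> //; apply: (fsubsetP hS).
apply: suc_eqv_trans (suc_eqv_mstar _ h); apply: (suc_eqv_star h).
by apply: IH hl _; apply: fsetSD.
Qed.

Lemma suc_eqv_svars xs S F Y Z : lists xs S -> S `<=` F ->
  suc_eqv (F `\` S) Y Z -> suc_eqv F (svars xs Y) (svars xs Z).
Proof.
elim: xs S F => [|x xs IH] S F /=.
  case=> _ h _; suff -> : F `\` S = F by [].
  by apply/fsetP => v; rewrite in_fsetD -h.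
case/lists_consP=> hx _ hl hS e.
have h : star_typed (StarVar L x) (F `\ x) F.
  by split=> //; apply: (fsubsetP hS).
apply: (suc_eqv_star h); apply: IH hl _ _; first exact: fsetSD.
suff -> : F `\ x `\` (S `\ x) = F `\` S by [].
by apply/fsetP => v; rewrite !inE; case: eqP => //= ->; rewrite hx.
Qed.

Lemma mtyped_mvars xs S F A : lists xs S ->
  mtyped F (mvars xs A) = (S `<=` F) && mtyped (F `\` S) A.
Proof.
elim: xs S F => [|x xs IH] S F /=.
  case=> _ h; have -> : S = fset0 by apply/fsetP => v; rewrite -h inE.
  by rewrite fsub0set fsetD0.
case/lists_consP => hx _ /IH ->.
exact: (@typed_consE x S F (fun G => mtyped G A)).
Qed.

(** Substituting for the vacuous variable [y] discards [s]. The variables that only [s] contributed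
    to the type return as weakenings. *)
Lemma msub_var tF s y zs A : y \notin domf tF ->
  lists zs (tfv s `\` famfv tF) -> mtyped (domf tF) A ->
  eqv (famfv tF.[y <- s]) (MSub tF.[y <- s] (MVar y A)) (mvars zs (MSub tF A)).
Proof.
move=> hy hzs wA; have ht := star_typedS tF.
set F := famfv tF.[y <- s].
have h : star_typed (StarSub tF.[y <- s]) (y |` domf tF) F.
  by split; rewrite ?dom_setf.
have hV := star_typedV hy.
have hF : tfv s `\` famfv tF `<=` F.
  by apply/fsubsetP => v; rewrite /F famfv_set // !inE => /andP [_ ->].
have e : F `\` (tfv s `\` famfv tF) = famfv tF.
  apply/fsetP => v; rewrite /F famfv_set // !inE.
  by case: (v \in tfv s); case: (v \in famfv tF).
apply: suc_eqv_le.
  by rewrite (mtyped_star h (MVar y A)) (mtyped_star hV A).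
apply: suc_eqv_trans (suc_eqv_sym (suc_eqv_mstar _ h)) _.
apply: suc_eqv_trans (suc_eqv_star h (suc_eqv_sym (suc_eqv_mstar _ hV))) _.
apply: suc_eqv_trans (suc_eqv_mvars _ hzs hF).
apply: suc_eqv_trans (suc_eqv_svars hzs hF _); last first.
  rewrite e; exact: (suc_eqv_mstar _ ht).
by move=> X; apply: derivable_birule; constructor.
Qed.

(** * Weakening lists and atoms *)

Lemma eqv_typed F A B : eqv F A B -> mtyped F A.
Proof. by case=> /le_typedl. Qed.

Lemma eqv_var x F A B : x \in F -> eqv (F `\ x) A B ->
  eqv F (MVar x A) (MVar x B).
Proof. by move=> hx; apply: (@eqv_star (StarVar L x)). Qed.

Lemma eqv_sub tF A B : eqv (domf tF) A B -> eqv (famfv tF) (MSub tF A) (MSub tF B).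
Proof. exact: (eqv_star (star_typedS tF)). Qed.

Lemma lists_enum S : lists (enum_fset S) S.
Proof. by split; [apply: fset_uniq | move=> v]. Qed.

Lemma fsetDD1 x S F : x \in S -> F `\ x `\` (S `\ x) = F `\` S.
Proof.
by move=> hx; apply/fsetP => v; rewrite !inE; case: eqP => //= ->; rewrite hx.
Qed.

Lemma lists_cons x xs S : x \in S -> lists xs (S `\ x) -> lists (x :: xs) S.
Proof.
move=> hx [u h]; split=> /=; first by rewrite u h in_fsetD1 eqxx.
by move=> v; rewrite inE h in_fsetD1; case: eqVneq => // ->.
Qed.

Lemma eqv_mvars xs S F A B : lists xs S -> S `<=` F ->
  eqv (F `\` S) A B -> eqv F (mvars xs A) (mvars xs B).
Proof.
elim: xs S F => [|x xs IH] S F /=.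
  case=> _ h _; suff -> : F `\` S = F by [].
  by apply/fsetP => v; rewrite in_fsetD -h.
case/lists_consP=> hx _ hl hS e; apply: eqv_var.
  exact: (fsubsetP hS).
by apply: IH hl _ _; [apply: fsetSD | rewrite fsetDD1].
Qed.

Lemma mvars_pull ys x S F A : lists ys S -> S `<=` F -> x \in S ->
  mtyped (F `\` S) A ->
  exists2 ys', lists ys' (S `\ x) & eqv F (mvars ys A) (MVar x (mvars ys' A)).
Proof.
elim: ys S F => [|y ys IH] S F hl hS hx wA; first by case: hl => _ /(_ x); rewrite hx.
have w : mtyped F (mvars (y :: ys) A) by rewrite (mtyped_mvars _ _ hl) hS.
case/lists_consP: (hl) => hy _ hl'.
case: (eqVneq x y) => [e|nxy].
  by exists ys; rewrite e //; apply: eqv_refl.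
have hyF : y \in F by apply: (fsubsetP hS).
have hxF : x \in F by apply: (fsubsetP hS).
case: (IH (S `\ y) (F `\ y)) => //.
- exact: fsetSD.
- by rewrite in_fsetD1 nxy.
- by rewrite fsetDD1.
move=> ys' hys' e; have eS : S `\ y `\ x = S `\ x `\ y.
  by apply/fsetP => v; rewrite !in_fsetD1 andbCA.
have e1 := eqv_var hyF e.
exists (y :: ys'); first by apply: lists_cons; rewrite -?eS // in_fsetD1 eq_sym nxy.
apply: (eqv_trans e1); apply: mvar_swap => //; first by rewrite eq_sym.
by move: (le_typedr (proj1 e1)) => /= /andP [_ /andP []].
Qed.

(** The rules produce lists of weakenings in their own order, while [pad] follows the enumeration of
    a set; this reconciles the two. *)
Lemma mvars_perm xs ys S F A : lists xs S -> lists ys S -> S `<=` F ->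
  mtyped (F `\` S) A -> eqv F (mvars xs A) (mvars ys A).
Proof.
elim: xs ys S F => [|x xs IH] ys S F hxs hys hS wA.
  suff -> : ys = [::].
    by apply: eqv_refl; rewrite (mtyped_mvars _ _ hxs) hS.
  case: hxs hys => _ h [_ h']; case: ys h' => // y ys /(_ y).
  by rewrite -h inE eqxx.
case/lists_consP: hxs => hx _ hxs.
have [ys' hys' e] := mvars_pull hys hS hx wA.
apply: eqv_trans (eqv_sym e); apply: eqv_var; first exact: (fsubsetP hS).
by apply: IH hxs hys' _ _; [apply: fsetSD | rewrite fsetDD1].
Qed.

Lemma famfv_rem_sub tF S : famfv tF.[\ S] `<=` famfv tF.
Proof.
apply/fsubsetP => v /in_famfv [u]; rewrite domf_rem in_fsetD => /andP [hu hS].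
by rewrite fam_sub_rem // => hv; apply/in_famfv; exists u.
Qed.

(** Iterates [msub_var]: the entries of [tF] on [S] are dropped one by one, and [zs] lists the
    variables that disappear with them. *)
Lemma msub_mvars xs S tF A : lists xs S -> S `<=` domf tF ->
  mtyped (domf tF `\` S) A ->
  exists2 zs, lists zs (famfv tF `\` famfv tF.[\ S]) &
    eqv (famfv tF) (MSub tF (mvars xs A)) (mvars zs (MSub tF.[\ S] A)).
Proof.
elim: xs S tF => [|x xs IH] S tF hl hS wA.
  have eS : S = fset0 by apply/fsetP => v; case: hl => _ <-.
  have et : tF.[\ S] = tF.
    apply: fam_ext => [|v _]; first by rewrite domf_rem eS fsetD0.
    by rewrite fam_sub_rem // eS.
  rewrite et fsetDv; exists [::] => //.
  by apply: eqv_refl; rewrite /= eqxx; rewrite eS fsetD0 in wA.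
case/lists_consP: hl => hx _ hl.
have hxt : x \in domf tF by apply: (fsubsetP hS).
set t1 := tF.[~ x]; have et1 : tF = t1.[x <- fam_sub tF x] by apply: fam_rem1K.
have hx1 : x \notin domf t1 by rewrite domf_rem in_fsetD1 eqxx.
have et' : t1.[\ S `\ x] = tF.[\ S].
  apply: fam_ext => [|v hv'].
    by rewrite !domf_rem fsetDD1.
  have hv : v \notin S.
    by move: hv'; rewrite !domf_rem fsetDD1 // in_fsetD => /andP [].
  have nvx : v != x by apply: contraNneq hv => ->.
  have hvS : v \notin S `\ x by rewrite in_fsetD1 (negbTE hv) andbF.
  have e1 : fam_sub t1 v = fam_sub tF v by apply: fam_sub_rem; rewrite in_fset1.
  by rewrite (fam_sub_rem _ hvS) e1 (fam_sub_rem _ hv).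
have [||zs2 hzs2 e2] := IH (S `\ x) t1 hl.
- by rewrite domf_rem; apply: fsetSD.
- by rewrite domf_rem fsetDD1.
rewrite et' in hzs2 e2.
have w1 : mtyped (domf t1) (mvars xs A).
  by case: e2 => /le_typedl /= /andP [].
set S1 := tfv (fam_sub tF x) `\` famfv t1.
have eF : famfv tF = tfv (fam_sub tF x) `|` famfv t1 by rewrite {1}et1 famfv_set.
have e1 := msub_var hx1 (lists_enum S1) w1; rewrite -et1 in e1.
(* [S1] is what dropping the entry at [x] loses; [zs2] is what the remaining entries of [S] lose
   afterwards. *)
exists (enum_fset S1 ++ zs2).
  have sub : famfv tF.[\ S] `<=` famfv t1 by rewrite -et'; apply: famfv_rem_sub.
  case: hzs2 => u2 h2; split.
    rewrite cat_uniq fset_uniq u2 andbT /=; apply/hasPn => v.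
    by rewrite h2 !inE => /andP [_ ->].
  move=> v; rewrite mem_cat h2 eF !inE.
  move/fsubsetP: sub => /(_ v).
  by case: (v \in famfv tF.[\ S]); case: (v \in famfv t1);
    rewrite ?andbF ?andbT ?orbF ?orbT //= => /(_ isT).
apply: (eqv_trans e1); rewrite /mvars foldr_cat.
apply: eqv_mvars (lists_enum S1) _ _.
  by apply/fsubsetP => v; rewrite eF !inE => /andP [_ ->].
suff -> : famfv tF `\` S1 = famfv t1 by [].
apply/fsetP => v; rewrite eF !inE.
by case: (v \in tfv _); case: (v \in famfv t1).
Qed.

(** An atom has exactly the set of its variables as type, so it must be weakened to occur at a
    larger one. *)
Definition pad F G A : mform L := mvars (enum_fset (F `\` G)) A.

Lemma mtyped_pad F G A : G `<=` F -> mtyped G A -> mtyped F (pad F G A).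
Proof.
move=> h w; rewrite (mtyped_mvars _ _ (lists_enum _)) fsubsetDl.
suff -> : F `\` (F `\` G) = G by [].
exact/fsetDK.
Qed.

Lemma mvar_pad x F G A : x \notin F -> G `<=` F -> mtyped G A ->
  eqv (x |` F) (MVar x (pad F G A)) (pad (x |` F) G A).
Proof.
move=> hx hG wA.
have hxG : x \notin G by apply: contra hx => /(fsubsetP hG).
have eS : (x |` F `\` G) `\ x = F `\` G.
  by apply/fsetP => v; rewrite !inE; case: eqP => //= ->; rewrite (negbTE hx) andbF.
apply: (@mvars_perm (x :: _) _ (x |` F `\` G)).
- by apply: lists_cons; rewrite ?eS ?inE ?eqxx //; exact: lists_enum.
- suff -> : x |` F `\` G = (x |` F) `\` G by apply: lists_enum.
  by apply/fsetP => v; rewrite !inE; case: eqP => //= ->; rewrite hxG.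
- by apply/fsubsetP => v; rewrite !inE => /orP [->|/andP [_ ->]]; rewrite ?orbT.
suff -> : (x |` F) `\` (x |` F `\` G) = G by [].
apply/fsetP => v; rewrite !inE; move/fsubsetP: hG => /(_ v).
case: eqP => [->|_] //=; first by rewrite (negbTE hxG).
by case: (v \in G); case: (v \in F) => //= /(_ isT).
Qed.

(** Only the restriction [t'] of [tF] to [G] reaches [A]; variables occurring solely in the other
    entries come back as padding. *)
Lemma msub_pad tF G A B : G `<=` domf tF -> mtyped G A ->
  let t' := tF.[\ domf tF `\` G] in
  eqv (famfv t') (MSub t' A) B ->
  eqv (famfv tF) (MSub tF (pad (domf tF) G A)) (pad (famfv tF) (famfv t') B).
Proof.
move=> hG wA t' e.
have hsub : famfv t' `<=` famfv tF by apply: famfv_rem_sub.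
have eG : domf tF `\` (domf tF `\` G) = G by exact/fsetDK.
have [||zs hzs e1] := msub_mvars (lists_enum (domf tF `\` G)) (A := A) (tF := tF).
- exact: fsubsetDl.
- by rewrite eG.
have eF : famfv tF `\` (famfv tF `\` famfv t') = famfv t' by exact/fsetDK.
apply: (eqv_trans e1).
apply: eqv_trans (mvars_perm hzs (lists_enum _) _ _) _.
- exact: fsubsetDl.
- by rewrite eF; apply: eqv_typed e.
apply: eqv_mvars (lists_enum _) _ _; first exact: fsubsetDl.
by rewrite eF.
Qed.

Lemma pre_eqv_rel F R (a : {ffun 'I_(rel_ar R) -> term L}) :
  pre_eqv F (PRel a) (MRel a).
Proof.
move=> Y; split=> d; have w := derivable_pre d.
  apply: (derivable_rule1 (r_rel_left _ _ _) _ d).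
  by rewrite /well_typed /= (derivable_suc d) andbT.
apply: (fun e => cut e d); apply: (derivable_rule0 (r_id_rel _ _)).
by rewrite /well_typed /= andbb.
Qed.

Lemma pre_eqv_eq F s t : pre_eqv F (PEq s t) (MEq s t).
Proof.
move=> Y; split=> d; have w := derivable_pre d.
  apply: (derivable_rule1 (r_eq_left _ _ _ _) _ d).
  by rewrite /well_typed /= (derivable_suc d) andbT.
apply: (fun e => cut e d); apply: (derivable_rule0 (r_id_eq _ _ _)).
by rewrite /well_typed /= andbb.
Qed.

Lemma famfv_tsubst tF n (a : {ffun 'I_n -> term L}) : domf tF = argfv a ->
  argfv [ffun i => tsubst (fam_sub tF) (a i)] = famfv tF.
Proof.
move=> h; apply/fsetP => v; apply/idP/idP.
  by move/in_argfv_tsubst => [u hu hv]; apply/in_famfv; exists u; rewrite ?h.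
by move/in_famfv => [u hu hv]; apply/in_argfv_tsubst; exists u; rewrite -?h.
Qed.

Lemma famfv_tsubst2 tF s t : domf tF = tfv s `|` tfv t ->
  tfv (tsubst (fam_sub tF) s) `|` tfv (tsubst (fam_sub tF) t) = famfv tF.
Proof.
move=> h; apply/fsetP => v; rewrite in_fsetU; apply/orP/idP.
  by case=> /in_tfv_tsubst [u hu hv]; apply/in_famfv; exists u;
    rewrite ?h ?in_fsetU ?hu ?orbT.
move/in_famfv => [u]; rewrite h in_fsetU => /orP [] hu hv;
  [left|right]; by apply/in_tfv_tsubst; exists u.
Qed.

(** By computation both atoms have the same translation, so [r_atom_rel] applies in either
    direction, with one explicit substitution on one side and none on the other. *)
Lemma msub_rel tF R (a : {ffun 'I_(rel_ar R) -> term L}) : domf tF = argfv a ->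
  eqv (famfv tF) (MSub tF (MRel a)) (MRel [ffun i => tsubst (fam_sub tF) (a i)]).
Proof.
move=> h; have ht : star_typed (StarSub tF) (argfv a) (famfv tF) by rewrite -h.
apply: pre_eqv_le; first by rewrite (mtyped_star ht (MRel a)) /=.
apply: pre_eqv_trans (pre_eqv_sym (pre_eqv_mstar _ ht)) _.
apply: pre_eqv_trans (pre_eqv_star ht (pre_eqv_sym (pre_eqv_rel _ a))) _.
apply: pre_eqv_trans (pre_eqv_rel _ _).
move=> Y; split=> d; have w := derivable_suc d.
  apply: (derivable_rule1 _ _ d);
    last by rewrite /well_typed /= famfv_tsubst // eqxx w.
  exact: (@r_atom_rel L _ R _ _ [::] [:: tF]).
apply: (derivable_rule1 _ _ d); last by rewrite /well_typed /= h !eqxx w.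
exact: (@r_atom_rel L _ R _ _ [:: tF] [::]).
Qed.

Lemma msub_eq tF s t : domf tF = tfv s `|` tfv t ->
  eqv (famfv tF) (MSub tF (MEq s t))
    (MEq (tsubst (fam_sub tF) s) (tsubst (fam_sub tF) t)).
Proof.
move=> h; have ht : star_typed (StarSub tF) (tfv s `|` tfv t) (famfv tF) by rewrite -h.
apply: pre_eqv_le; first by rewrite (mtyped_star ht (MEq s t)) /=.
apply: pre_eqv_trans (pre_eqv_sym (pre_eqv_mstar _ ht)) _.
apply: pre_eqv_trans (pre_eqv_star ht (pre_eqv_sym (pre_eqv_eq _ s t))) _.
apply: pre_eqv_trans (pre_eqv_eq _ _ _).
move=> Y; split=> d; have w := derivable_suc d.
  apply: (derivable_rule1 _ _ d);
    last by rewrite /well_typed /= famfv_tsubst2 // eqxx w.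
  exact: (@r_atom_eq L _ _ _ _ _ [::] [:: tF]).
apply: (derivable_rule1 _ _ d); last by rewrite /well_typed /= h !eqxx w.
exact: (@r_atom_eq L _ _ _ _ _ [:: tF] [::]).
Qed.

(** No rule says this directly. It follows by induction, since the identity family commutes with
    every connective and is a unit for composition. *)
Lemma msub_id F A : mtyped F A -> eqv F (MSub (fam_id F) A) A.
Proof.
have hid G : star_typed (StarSub (fam_id G)) G G by split; rewrite ?famfv_id.
elim: A F => [R a|s t|G|G|B IHB C IHC|B IHB C IHC|B IHB C IHC|y B IH|y B IH
  |x B IH|tF B IH] F w.
- have := @msub_rel (fam_id F) R a; rewrite famfv_id; move: w => /= /eqP ->.
  move/(_ erefl); congr (eqv _ _ (MRel _)); apply/ffunP => i; rewrite ffunE.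
  rewrite -[RHS]tsubst_Var; apply: eq_tsubst => v _; exact: fam_sub_id.
- have := @msub_eq (fam_id F) s t; rewrite famfv_id; move: w => /= /eqP ->.
  move/(_ erefl); congr (eqv _ _ (MEq _ _));
  rewrite -[RHS]tsubst_Var; apply: eq_tsubst => v _; exact: fam_sub_id.
- move: w => /= /eqP ->; exact: (mstar_top (hid F)).
- move: w => /= /eqP ->; exact: (mstar_bot (hid F)).
- move: w => /= /andP [wB wC]; apply: eqv_trans (mstar_and (hid F) wB wC) _.
  by apply: eqv_and; [apply: IHB | apply: IHC].
- move: w => /= /andP [wB wC]; apply: eqv_trans (mstar_or (hid F) wB wC) _.
  by apply: eqv_or; [apply: IHB | apply: IHC].
- move: w => /= /andP [wB wC]; apply: eqv_trans (mstar_imp (hid F) wB wC) _.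
  by apply: eqv_imp; [apply: IHB | apply: IHC].
- move: w => /= /andP [hy wB].
  (* The name [y] can be kept because it lies outside [F], and the extended family is again an
     identity. *)
  have := @msub_quant true (fam_id F) y y B.
  rewrite famfv_id fsetUid => /(_ hy hy wB).
  move=> e; apply: eqv_trans e _; apply: (@eqv_quant true) => //.
  by rewrite fam_id_set; apply: IH.
- move: w => /= /andP [hy wB].
  have := @msub_quant false (fam_id F) y y B.
  rewrite famfv_id fsetUid => /(_ hy hy wB).
  move=> e; apply: eqv_trans e _; apply: (@eqv_quant false) => //.
  by rewrite fam_id_set; apply: IH.
- move: w => /= /andP [hx wB].
  have hx' : x \notin domf (fam_id (F `\ x)) by rewrite in_fsetD1 eqxx.
  (* Seen as an extension at [x], the identity loses exactly the variable [x], which gives back the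
     weakening. *)
  have := @msub_var (fam_id (F `\ x)) (Var x) x [:: x] B hx'.
  rewrite fam_id_set !famfv_id fsetD1K //= => e; apply: eqv_trans (e _ wB) _.
    split=> // v; by rewrite !inE; case: eqP; rewrite ?andbT ?andbF.
  by apply: eqv_var => //; apply: IH.
- move: w => /= /andP [/eqP hF wB].
  have := @msub_comp (fam_id F) tF B (esym hF) wB; rewrite famfv_id.
  suff -> : fam_comp (fam_id F) tF = tF by [].
  apply: fam_ext => // v hv; rewrite fam_sub_comp // -[RHS]tsubst_Var.
  by apply: eq_tsubst => u _; apply: fam_sub_id.
Qed.

(** Alpha-conversion inside the calculus: insert the identity family on [F] and push it under the
    quantifier with the name [z]. *)
Lemma quant_rename b y z F A : y \notin F -> z \notin F ->
  mtyped (y |` F) A ->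
  eqv F (mquant b y A) (mquant b z (MSub (fam_id F).[y <- Var z] A)).
Proof.
move=> hy hz wA; apply: eqv_trans (eqv_sym (msub_id _)) _.
  by rewrite mtyped_quant.
have := @msub_quant b (fam_id F) y z A.
by rewrite famfv_id fsetUid; apply.
Qed.

(** * Normal forms *)

(** Carrying [sg] as a parameter keeps the recursion structural. The bound variable always becomes
    [fresh F], whatever its original name and the body. *)
Fixpoint nf F sg phi : mform L :=
  match phi with
  | Rel R a => let b := [ffun i => tsubst sg (a i)] in pad F (argfv b) (MRel b)
  | Eq s t => let s' := tsubst sg s in let t' := tsubst sg t in
      pad F (tfv s' `|` tfv t') (MEq s' t')
  | Top => MTop F
  | Bot => MBot F
  | And B C => MAnd (nf F sg B) (nf F sg C)
  | Or B C => MOr (nf F sg B) (nf F sg C)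
  | Imp B C => MImp (nf F sg B) (nf F sg C)
  | All y B => let z := fresh F in MAll z (nf (z |` F) (upd sg y (Var z)) B)
  | Ex y B => let z := fresh F in MEx z (nf (z |` F) (upd sg y (Var z)) B)
  end.

Definition quant (b : bool) : var -> form L -> form L :=
  if b then @All L else @Ex L.

Lemma nf_quant b F sg y phi : nf F sg (quant b y phi) =
  mquant b (fresh F) (nf (fresh F |` F) (upd sg y (Var (fresh F))) phi).
Proof. by case: b. Qed.

Lemma fv_quant b y phi : fv (quant b y phi) = fv phi `\ y.
Proof. by case: b. Qed.

Lemma form_quant_ind (P : form L -> Prop) :
  (forall R a, P (@Rel L R a)) -> (forall s t, P (Eq s t)) -> P Top -> P Bot ->
  (forall phi psi, P phi -> P psi -> P (And phi psi)) ->
  (forall phi psi, P phi -> P psi -> P (Or phi psi)) ->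
  (forall phi psi, P phi -> P psi -> P (Imp phi psi)) ->
  (forall b y phi, P phi -> P (quant b y phi)) -> forall phi, P phi.
Proof.
move=> hR hE hT hB hA hO hI hQ.
by elim=> *; [apply: hR|apply: hE|apply: hT|apply: hB|apply: hA|apply: hO
  |apply: hI|apply: (hQ true)|apply: (hQ false)].
Qed.

(** For the free variables of a formula this makes its normal form well typed. [V] is a parameter
    because a Hilbert proof involves further variables. *)
Definition covers F sg (V : {fset var}) : Prop :=
  forall v, v \in V -> tfv (sg v) `<=` F.

Lemma covers_sub F G sg V : F `<=` G -> covers F sg V -> covers G sg V.
Proof. by move=> h c v /c /fsubset_trans; apply. Qed.

Lemma covers_upd F sg V y t : covers F sg (V `\ y) -> tfv t `<=` F ->
  covers F (upd sg y t) V.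
Proof.
move=> c ht v hv; case: (eqVneq v y) => [->|nvy]; first by rewrite upd_same.
by rewrite upd_neq //; apply: c; rewrite in_fsetD1 nvy.
Qed.

Lemma covers_bind z F sg y V : covers F sg (V `\ y) ->
  covers (z |` F) (upd sg y (Var z)) V.
Proof.
move=> c; apply: covers_upd; first exact: covers_sub (fsubsetU1 _ _) c.
by rewrite /= fsub1set fset1U1.
Qed.

Lemma coversU F sg (V W : {fset var}) :
  covers F sg (V `|` W) -> covers F sg V /\ covers F sg W.
Proof. by move=> c; split=> v hv; apply: c; rewrite in_fsetU hv ?orbT. Qed.

Lemma covers_args F sg n (a : {ffun 'I_n -> term L}) :
  covers F sg (argfv a) -> argfv [ffun i => tsubst sg (a i)] `<=` F.
Proof.
move=> c; apply/fsubsetP => v /in_argfv_tsubst [u hu].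
exact: (fsubsetP (c u hu)).
Qed.

Lemma covers_eq F sg s t :
  covers F sg (tfv s `|` tfv t) -> tfv (tsubst sg s) `|` tfv (tsubst sg t) `<=` F.
Proof.
case/coversU => cs ct; apply/fsubsetP => v; rewrite in_fsetU.
by case/orP => /in_tfv_tsubst [u hu];
  [apply: (fsubsetP (cs u hu))|apply: (fsubsetP (ct u hu))].
Qed.

Lemma mtyped_nf F sg phi : covers F sg (fv phi) -> mtyped F (nf F sg phi).
Proof.
elim/form_quant_ind: phi F sg => [R a|s t|||B C IHB IHC|B C IHB IHC|B C IHB IHC
  |b y B IH] F sg.
- by move=> /covers_args c; apply: mtyped_pad => //=.
- by move=> /covers_eq c; apply: mtyped_pad => //=.
- by move=> _ /=.
- by move=> _ /=.
- by case/coversU => cB cC /=; rewrite IHB // IHC.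
- by case/coversU => cB cC /=; rewrite IHB // IHC.
- by case/coversU => cB cC /=; rewrite IHB // IHC.
rewrite fv_quant nf_quant mtyped_quant ?fresh_notin // => c.
by apply: IH; apply: covers_bind.
Qed.

Lemma eq_nf F sg rho phi : {in fv phi, sg =1 rho} -> nf F sg phi = nf F rho phi.
Proof.
elim/form_quant_ind: phi F sg rho => [R a|s t|||B C IHB IHC|B C IHB IHC|B C IHB IHC
  |b y B IH] F sg rho h //=.
- by rewrite (eq_tsubst_args h).
- rewrite (@eq_tsubst sg rho s) ?(@eq_tsubst sg rho t) // => v hv;
    apply: h; by rewrite in_fsetU hv ?orbT.
1-3: by rewrite (IHB F sg rho) ?(IHC F sg rho) // => v hv; apply: h;
    rewrite in_fsetU hv ?orbT.
rewrite !nf_quant; congr (mquant _ _ _); apply: IH => v hv.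
rewrite /upd; case: eqP => // /eqP nvy; apply: h.
by rewrite fv_quant in_fsetD1 nvy.
Qed.

(** A syntactic equality: the name that [subst] gives to a bound variable is overwritten by
    [fresh F], and by [bound_nameP] the two composed substitutions agree on the free variables of
    the body. *)
Lemma nf_subst F sg rho phi :
  nf F rho (subst sg phi) = nf F (tsubst rho \o sg) phi.
Proof.
elim/form_quant_ind: phi F sg rho => [R a|s t|||B C IHB IHC|B C IHB IHC
  |B C IHB IHC|b y B IH] F sg rho //=.
- have -> : [ffun i => tsubst rho ([ffun j => tsubst sg (a j)] i)] =
    [ffun i => tsubst (tsubst rho \o sg) (a i)].
    by apply/ffunP => i; rewrite !ffunE tsubst_comp.
  by [].
- by rewrite !tsubst_comp.
1-3: by rewrite IHB IHC.
have -> : subst sg (quant b y B) =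
    quant b (bound_name sg y B) (subst (upd sg y (Var (bound_name sg y B))) B).
  by case: (b).
rewrite !nf_quant; congr (mquant _ _ _); rewrite IH; apply: eq_nf => v hv /=.
case: (eqVneq v y) => [->|nvy]; first by rewrite !upd_same /= upd_same.
rewrite !upd_neq //=; apply: eq_tsubst => u hu; rewrite upd_neq //.
by apply: contraTneq hu => ->; apply: bound_nameP.
Qed.

Lemma nf_alpha F sg phi psi : alpha phi psi -> nf F sg phi = nf F sg psi.
Proof.
move=> h; elim: h F sg => {phi psi}
  [A|A B _ IH|A B C _ IH1 _ IH2|A A' B B' _ IH1 _ IH2|A A' B B' _ IH1 _ IH2
  |A A' B B' _ IH1 _ IH2|x A A' _ IH|x A A' _ IH|x y A hy|x y A hy] F sg //=.
- by rewrite IH1 IH2.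
- by rewrite IH1 IH2.
- by rewrite IH1 IH2.
- by rewrite IH1 IH2.
- by rewrite IH.
- by rewrite IH.
all: rewrite nf_subst; congr (_ _ _); apply: eq_nf => v hv /=.
all: case: (eqVneq v x) => [->|nvx]; first by rewrite !upd_same /= upd_same.
all: have nvy : v != y by apply: contraNneq hy => <-; rewrite /= in_fsetD1 nvx.
all: by rewrite !upd_neq //= upd_neq.
Qed.

(** * Substitution, bound names and weakening on normal forms *)

(** The first hypothesis is [msub_nf] for the body; it is assumed because the lemma is already
    needed inside the induction that proves [msub_nf]. *)
Lemma eqv_bound b F z z' sg y phi :
  (forall tF sg, covers (domf tF) sg (fv phi) ->
     eqv (famfv tF) (MSub tF (nf (domf tF) sg phi))
       (nf (famfv tF) (tsubst (fam_sub tF) \o sg) phi)) ->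
  z \notin F -> z' \notin F -> covers F sg (fv phi `\ y) ->
  eqv F (mquant b z (nf (z |` F) (upd sg y (Var z)) phi))
    (mquant b z' (nf (z' |` F) (upd sg y (Var z')) phi)).
Proof.
move=> IH hz hz' c; have c' := covers_bind z c.
apply: (eqv_trans (quant_rename b hz hz' (mtyped_nf c'))).
apply: eqv_quant => //.
have := IH (fam_id F).[z <- Var z'] (upd sg y (Var z)).
rewrite dom_setf famfv_set // famfv_id => /(_ c').
congr (eqv _ _ _); apply: eq_nf => v hv /=.
case: (eqVneq v y) => [->|nvy].
  by rewrite !upd_same /= fam_sub_upd upd_same.
rewrite !upd_neq // -[RHS]tsubst_Var; apply: eq_tsubst => u hu.
rewrite fam_sub_upd upd_neq ?fam_sub_id //.
apply: contraNneq hz => <-; apply: (fsubsetP (c v _)) => //.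
by rewrite in_fsetD1 nvy.
Qed.

Lemma msub_nf tF sg phi : covers (domf tF) sg (fv phi) ->
  eqv (famfv tF) (MSub tF (nf (domf tF) sg phi))
    (nf (famfv tF) (tsubst (fam_sub tF) \o sg) phi).
Proof.
elim/form_quant_ind: phi tF sg => [R a|s t|||B C IHB IHC|B C IHB IHC|B C IHB IHC
  |b y B IH] tF sg c.
- rewrite /=; set b := [ffun i => tsubst sg (a i)].
  have hb : argfv b `<=` domf tF by apply: covers_args.
  set t' := tF.[\ domf tF `\` argfv b].
  have ht' : domf t' = argfv b by rewrite domf_rem; apply/fsetDK.
  have := @msub_pad tF _ _ _ hb _ (msub_rel ht') => /=; rewrite eqxx => /(_ isT).
  rewrite -/t' -(famfv_tsubst ht').
  suff -> : [ffun i => tsubst (fam_sub t') (b i)] =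
    [ffun i => tsubst (tsubst (fam_sub tF) \o sg) (a i)] by [].
  apply/ffunP => i; rewrite !ffunE -tsubst_comp; apply: eq_tsubst => v hv.
  apply: fam_sub_rem; rewrite in_fsetD negb_and negbK.
  suff -> : v \in argfv b by [].
  by apply/in_argfv; exists i; rewrite ffunE.
- rewrite /=; set s' := tsubst sg s; set r' := tsubst sg t.
  have hb : tfv s' `|` tfv r' `<=` domf tF by apply: covers_eq.
  set t' := tF.[\ domf tF `\` (tfv s' `|` tfv r')].
  have ht' : domf t' = tfv s' `|` tfv r' by rewrite domf_rem; apply/fsetDK.
  have := @msub_pad tF _ _ _ hb _ (msub_eq ht') => /=; rewrite eqxx => /(_ isT).
  rewrite -/t' -(famfv_tsubst2 ht') -!tsubst_comp -/s' -/r'.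
  have ext r : tfv r `<=` tfv s' `|` tfv r' ->
      tsubst (fam_sub t') r = tsubst (fam_sub tF) r.
    move=> h; apply: eq_tsubst => v hv; apply: fam_sub_rem.
    by rewrite in_fsetD negb_and negbK (fsubsetP h).
  by rewrite !ext // ?fsubsetUl ?fsubsetUr.
- exact: (mstar_top (star_typedS tF)).
- exact: (mstar_bot (star_typedS tF)).
- case/coversU: c => cB cC.
  apply: eqv_trans (mstar_and (star_typedS tF) (mtyped_nf cB) (mtyped_nf cC)) _.
  by apply: eqv_and; [apply: IHB | apply: IHC].
- case/coversU: c => cB cC.
  apply: eqv_trans (mstar_or (star_typedS tF) (mtyped_nf cB) (mtyped_nf cC)) _.
  by apply: eqv_or; [apply: IHB | apply: IHC].
- case/coversU: c => cB cC.
  apply: eqv_trans (mstar_imp (star_typedS tF) (mtyped_nf cB) (mtyped_nf cC)) _.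
  by apply: eqv_imp; [apply: IHB | apply: IHC].
rewrite fv_quant in c; rewrite !nf_quant; set w := fresh (domf tF).
(* The target name [fresh (famfv tF)] may lie in [domf tF], where [msub_quant] forbids it. The proof
   passes through [z] and renames with [eqv_bound]. *)
set z := fresh (famfv tF `|` domf tF).
have hw : w \notin domf tF := fresh_notin _.
have hz : z \notin famfv tF `|` domf tF := fresh_notin _.
have hzt : z \notin famfv tF by move: hz; rewrite in_fsetU negb_or => /andP [].
have cw := covers_bind w c.
apply: (eqv_trans (msub_quant b hw hz (mtyped_nf cw))).
have ct : covers (famfv tF) (tsubst (fam_sub tF) \o sg) (fv B `\ y).
  move=> v hv; apply/fsubsetP => u /in_tfv_tsubst [r hr hu].
  by apply/in_famfv; exists r => //; apply: (fsubsetP (c v hv)).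
apply: eqv_trans _ (eqv_bound b IH hzt (fresh_notin _) ct).
apply: eqv_quant => //.
have := IH tF.[w <- Var z] (upd sg y (Var w)).
rewrite dom_setf famfv_set // => /(_ cw).
congr (eqv _ _ _); apply: eq_nf => v hv /=.
case: (eqVneq v y) => [->|nvy].
  by rewrite !upd_same /= fam_sub_upd upd_same.
rewrite !upd_neq //=; apply: eq_tsubst => u hu.
rewrite fam_sub_upd upd_neq //.
apply: contraNneq hw => <-; apply: (fsubsetP (c v _)) => //.
by rewrite in_fsetD1 nvy.
Qed.

(** Needed when the type changes, since [fresh F] then changes too. *)
Lemma nf_bound b F z sg y phi : z \notin F -> covers F sg (fv phi `\ y) ->
  eqv F (nf F sg (quant b y phi)) (mquant b z (nf (z |` F) (upd sg y (Var z)) phi)).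
Proof.
move=> hz c; rewrite nf_quant; apply: eqv_bound => //; last exact: fresh_notin.
by move=> tF sg'; apply: msub_nf.
Qed.

Lemma mvar_nf F sg phi x : x \notin F -> covers F sg (fv phi) ->
  eqv (x |` F) (MVar x (nf F sg phi)) (nf (x |` F) sg phi).
Proof.
elim/form_quant_ind: phi F sg => [R a|s t|||B C IHB IHC|B C IHB IHC|B C IHB IHC
  |b y B IH] F sg hx c.
- by apply: mvar_pad => //=; apply: covers_args.
- by apply: mvar_pad => //=; apply: covers_eq.
- exact: (mstar_top (star_typedV hx)).
- exact: (mstar_bot (star_typedV hx)).
- case/coversU: c => cB cC.
  apply: eqv_trans (mstar_and (star_typedV hx) (mtyped_nf cB) (mtyped_nf cC)) _.
  by apply: eqv_and; [apply: IHB | apply: IHC].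
- case/coversU: c => cB cC.
  apply: eqv_trans (mstar_or (star_typedV hx) (mtyped_nf cB) (mtyped_nf cC)) _.
  by apply: eqv_or; [apply: IHB | apply: IHC].
- case/coversU: c => cB cC.
  apply: eqv_trans (mstar_imp (star_typedV hx) (mtyped_nf cB) (mtyped_nf cC)) _.
  by apply: eqv_imp; [apply: IHB | apply: IHC].
(* This name is admissible both before and after the weakening by [x]. *)
rewrite fv_quant in c; set z := fresh (x |` F).
have hz : z \notin x |` F := fresh_notin _.
have /andP [nzx hzF] : (z != x) && (z \notin F) by move: hz; rewrite in_fset1U negb_or.
have hxz : x \notin z |` F by rewrite in_fset1U negb_or eq_sym nzx.
apply: eqv_trans (eqv_star (star_typedV hx) (nf_bound b hzF c)) _.
apply: eqv_trans (eqv_sym (nf_bound b hz (covers_sub (fsubsetU1 _ _) c))).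
have cz := covers_bind z c.
apply: eqv_trans (mvar_quant b (fset1U1 x F) hz _) _.
  by rewrite fsetU1K //; apply: mtyped_nf.
by apply: eqv_quant => //; rewrite fsetUCA; apply: IH.
Qed.

Lemma covers_Var F : covers F Var F.
Proof. by move=> v hv; rewrite /= fsub1set. Qed.

Lemma covers_VarE F (V : {fset var}) : V `<=` F <-> covers F Var V.
Proof.
split=> [h v /(fsubsetP h)|c]; first exact: covers_Var.
by apply/fsubsetP => v /c; rewrite fsub1set.
Qed.

(** Only an inclusion, since weakenings and the constants top and bottom may declare variables that
    do not occur. *)
Lemma fv_tau F A : mtyped F A -> fv (tau A) `<=` F.
Proof.
elim: A F => [R a|s t|G|G|B IHB C IHC|B IHB C IHC|B IHB C IHC|y B IH|y B IH
  |x B IH|tF B IH] F /=.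
- by move/eqP=> ->.
- by move/eqP=> ->.
- by rewrite fsub0set.
- by rewrite fsub0set.
- by case/andP=> /IHB hB /IHC hC; rewrite fsubUset hB.
- by case/andP=> /IHB hB /IHC hC; rewrite fsubUset hB.
- by case/andP=> /IHB hB /IHC hC; rewrite fsubUset hB.
- by case/andP=> _ /IH; rewrite fsubDset.
- by case/andP=> _ /IH; rewrite fsubDset.
- by case/andP=> _ /IH h; apply: fsubset_trans h _; apply: fsubD1set.
- case/andP=> /eqP <- /IH h; apply/fsubsetP => v /in_fv_subst [u hu hv].
  by apply/in_famfv; exists u => //; apply: (fsubsetP h).
Qed.

Lemma eqv_nf F A : mtyped F A -> eqv F A (nf F Var (tau A)).
Proof.
have quant_case b y B G : y \notin G -> mtyped (y |` G) B ->
    eqv (y |` G) B (nf (y |` G) Var (tau B)) ->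
    eqv G (mquant b y B) (nf G Var (quant b y (tau B))).
  move=> hy wB e; apply: eqv_trans (eqv_quant b hy e) _.
  have c : covers G Var (fv (tau B) `\ y).
    by apply/covers_VarE; rewrite fsubDset; apply: fv_tau.
  (* The original name [y] is outside the type, so the normal form may use it and [Var] need not be
     changed. *)
  apply: eqv_trans (eqv_sym (nf_bound b hy c)); apply: eqv_quant => //.
  rewrite (@eq_nf _ Var (upd Var y (Var y))) => [|v _].
    apply: eqv_refl; apply: mtyped_nf; exact: covers_bind.
  by rewrite /upd; case: eqP => // ->.
elim: A F => [R a|s t|G|G|B IHB C IHC|B IHB C IHC|B IHB C IHC|y B IH|y B IH
  |x B IH|tF B IH] F w.
- rewrite /=; have -> : [ffun i => tsubst Var (a i)] = a.
    by apply/ffunP => i; rewrite ffunE tsubst_Var.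
  by move: (w) => /= /eqP ->; rewrite /pad fsetDv; apply: eqv_refl.
- rewrite /= !tsubst_Var.
  by move: (w) => /= /eqP ->; rewrite /pad fsetDv; apply: eqv_refl.
- by move: w => /= /eqP ->; apply: eqv_refl => /=.
- by move: w => /= /eqP ->; apply: eqv_refl => /=.
- by move: w => /= /andP [wB wC]; apply: eqv_and; [apply: IHB | apply: IHC].
- by move: w => /= /andP [wB wC]; apply: eqv_or; [apply: IHB | apply: IHC].
- by move: w => /= /andP [wB wC]; apply: eqv_imp; [apply: IHB | apply: IHC].
- by move: w => /= /andP [hy wB]; apply: (quant_case true) => //; apply: IH.
- by move: w => /= /andP [hy wB]; apply: (quant_case false) => //; apply: IH.
- move: w => /= /andP [hx wB]; apply: eqv_trans (eqv_var hx (IH _ wB)) _.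
  have hx' : x \notin F `\ x by rewrite in_fsetD1 eqxx.
  have := @mvar_nf _ Var (tau B) x hx'; rewrite fsetD1K //; apply.
  by apply/covers_VarE; apply: fv_tau.
- move: w => /= /andP [/eqP <- wB]; apply: eqv_trans (eqv_sub (IH _ wB)) _.
  rewrite nf_subst; have c : covers (domf tF) Var (fv (tau B)).
    by apply/covers_VarE; apply: fv_tau.
  apply: (eqv_trans (msub_nf c)); rewrite (@eq_nf _ _ (tsubst Var \o fam_sub tF)).
    apply: eqv_refl; apply: mtyped_nf => v hv /=; rewrite tsubst_Var.
    apply/fsubsetP => u hu; apply/in_famfv; exists v => //.
    by apply: (fsubsetP (fv_tau wB)).
  by move=> v _ /=; rewrite tsubst_Var.
Qed.

(** * Hilbert axioms *)

Lemma le_top_imp F A B : le F A B -> le F (MTop F) (MImp A B).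
Proof.
move=> h; have w := le_typedl h.
by apply/le_imp; apply: (fun e => le_trans e h); apply: le_andl => /=.
Qed.

Lemma all_elim F y A : y \notin F -> mtyped (y |` F) A ->
  le (y |` F) (MVar y (MAll y A)) A.
Proof. by move=> hy w; apply/all_adj => //; apply: form_refl; rewrite /= hy. Qed.

Lemma ex_intro F y A : y \notin F -> mtyped (y |` F) A ->
  le (y |` F) A (MVar y (MEx y A)).
Proof. by move=> hy w; apply/ex_adj => //; apply: form_refl; rewrite /= hy. Qed.

Lemma mvar_neg F y A : y \notin F -> mtyped F A ->
  eqv (y |` F) (MVar y (mneg F A)) (mneg (y |` F) (MVar y A)).
Proof.
move=> hy w; have h := star_typedV hy.
apply: eqv_trans (mstar_imp h w (B := MBot F) _) _ => //=.
apply: eqv_imp; last exact: (mstar_bot h).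
by apply: eqv_refl; rewrite /= fset1U1 fsetU1K.
Qed.

(* If [D] decides [phi] it induces a valuation, and [D] implies [phi] or its
   negation according to the value of [phi]; excluded middle reduces any
   [D] to formulas that decide [phi]. *)
Fixpoint decides F sg D phi : Prop :=
  match phi with
  | Top | Bot => True
  | And B C | Or B C | Imp B C => decides F sg D B /\ decides F sg D C
  | _ => le F D (nf F sg phi) \/ le F D (mneg F (nf F sg phi))
  end.

Lemma decides_le F sg C D phi : le F C D -> decides F sg D phi -> decides F sg C phi.
Proof.
move=> h; elim: phi => [R a|s t|||B IHB E IHE|B IHB E IHE|B IHB E IHE|y B IH|y B IH] //=.
all: try by case=> [d|d]; [left|right]; apply: le_trans d.
all: by case=> dB dE; split; [apply: IHB | apply: IHE].
Qed.

(** Quantifying over every deciding [C] below [D] replaces a disjunctive normal form: cases are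
    split one propositional atom at a time, without writing conjunctions of literals. *)
Lemma le_decides F sg D A phi : covers F sg (fv phi) -> mtyped F D ->
  (forall C, le F C D -> decides F sg C phi -> le F C A) -> le F D A.
Proof.
have atom psi C : covers F sg (fv psi) -> mtyped F C ->
    (forall E, le F E C ->
       le F E (nf F sg psi) \/ le F E (mneg F (nf F sg psi)) -> le F E A) ->
    le F C A.
  move=> /mtyped_nf w wC h.
  have w' : mtyped F (mneg F (nf F sg psi)) by rewrite /= w eqxx.
  apply: (le_case w); apply: h; try exact: le_andr.
    by left; apply: le_andl.
  by right; apply: le_andl.
have pair (B C : form L) E : covers F sg (fv B `|` fv C) ->
    (forall D, covers F sg (fv B) -> mtyped F D ->
      (forall C', le F C' D -> decides F sg C' B -> le F C' A) -> le F D A) ->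
    (forall D, covers F sg (fv C) -> mtyped F D ->
      (forall C', le F C' D -> decides F sg C' C -> le F C' A) -> le F D A) ->
    mtyped F E ->
    (forall D, le F D E -> decides F sg D B /\ decides F sg D C -> le F D A) ->
    le F E A.
  (* Decide [B] first and then, below the result, [C]; the first decision survives the
     strengthening. *)
  move=> /coversU [cB cC] hB hC wE h; apply: hB => // D1 h1 d1.
  apply: hC => //; first exact: le_typedl h1.
  move=> D2 h2 d2; apply: h; first exact: le_trans h1.
  by split=> //; apply: decides_le d1.
elim: phi D => [R a|s t|||B IHB E IHE|B IHB E IHE|B IHB E IHE|y B IH|y B IH] D c wD h.
- exact: (atom (Rel a)).
- exact: (atom (Eq s t)).
- by apply: h => //; apply: form_refl.
- by apply: h => //; apply: form_refl.
- exact: (pair B E).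
- exact: (pair B E).
- exact: (pair B E).
- exact: (atom (All y B)).
- exact: (atom (Ex y B)).
Qed.

(** Derivability is a proposition while [peval] expects Booleans, so a classical decision is
    taken. *)
Definition induced_val F sg D phi : bool :=
  if excluded_middle_informative (le F D (nf F sg phi)) then true else false.

(** Kalmár's lemma. An inconsistent [D] does no harm: its atoms count as true, and [D] does imply
    them. *)
Lemma decides_peval F sg D phi : covers F sg (fv phi) -> mtyped F D ->
  decides F sg D phi ->
  if peval (induced_val F sg D) phi then le F D (nf F sg phi)
  else le F D (mneg F (nf F sg phi)).
Proof.
move=> c wD.
have atom psi : le F D (nf F sg psi) \/ le F D (mneg F (nf F sg psi)) ->
    if induced_val F sg D psi then le F D (nf F sg psi)
    else le F D (mneg F (nf F sg psi)).
  by rewrite /induced_val; case: excluded_middle_informative => // h [].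
elim: phi c => [R a|s t|||B IHB C IHC|B IHB C IHC|B IHB C IHC|y B IH|y B IH] c d.
- exact: (atom (Rel a)).
- exact: (atom (Eq s t)).
- exact: le_top.
- by apply/le_imp/le_andl => //=.
- case/coversU: c d => cB cC [dB dC]; move: (IHB cB dB) (IHC cC dC) => /=.
  have wB := mtyped_nf cB; have wC := mtyped_nf cC.
  case: (peval _ B) => hB; last first.
    move=> _; apply: (le_trans hB); apply: le_imp2; first exact: le_andl.
    by apply: form_refl => /=.
  case: (peval _ C) => hC; first exact: le_and.
  apply: (le_trans hC); apply: le_imp2; first exact: le_andr.
  by apply: form_refl => /=.
- case/coversU: c d => cB cC [dB dC]; move: (IHB cB dB) (IHC cC dC) => /=.
  have wB := mtyped_nf cB; have wC := mtyped_nf cC.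
  case: (peval _ B) => hB; first by move=> _; apply: (le_trans hB); apply: le_orl.
  case: (peval _ C) => hC; first by apply: (le_trans hC); apply: le_orr.
  by apply: le_imp_swap; apply: le_or; apply: le_imp_swap.
- case/coversU: c d => cB cC [dB dC]; move: (IHB cB dB) (IHC cC dC) => /=.
  have wB := mtyped_nf cB; have wC := mtyped_nf cC.
  have wBot : mtyped F (MBot F : mform L) by rewrite /=.
  case: (peval _ B) => hB /=; last first.
    move=> _; apply: (le_trans hB); apply: le_imp2; first exact: form_refl.
    exact: le_bot.
  case: (peval _ C) => hC.
    apply: (le_trans hC); apply/le_imp; exact: le_andr.
  have wI : mtyped F (MImp (nf F sg B) (nf F sg C)) by rewrite /= wB.
  apply/le_imp; apply: (@le_mp _ (nf F sg C)).
    by apply: (fun e => le_trans e hC); apply: le_andr.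
  apply: (@le_mp _ (nf F sg B)); first exact: le_andl.
  by apply: (fun e => le_trans e hB); apply: le_andr.
- exact: (atom (All y B)).
- exact: (atom (Ex y B)).
Qed.

Lemma nf_tautology F sg phi : covers F sg (fv phi) -> tautology phi ->
  le F (MTop F) (nf F sg phi).
Proof.
move=> c h; apply: (le_decides c); first by rewrite /=.
move=> C hC d; have := decides_peval c (le_typedl hC) d.
by rewrite h.
Qed.

(** * Instantiation and equality *)

(** Since [s] brings no variable beyond [F], [msub_var] yields an empty list of weakenings and
    leaves just the identity family. *)
Lemma inst_var F w s A : w \notin F -> tfv s `<=` F -> mtyped F A ->
  eqv F (MSub (fam_id F).[w <- s] (MVar w A)) A.
Proof.
move=> hw hs wA; have e := @msub_var (fam_id F) s w [::] A hw.
rewrite famfv_set // famfv_id (fsetUidPr _ _ hs) in e.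
apply: eqv_trans (e _ wA) (msub_id wA); split=> // v.
by rewrite inE in_fsetD; apply/esym/negbTE; rewrite negb_and negbK;
  case: (boolP (v \in tfv s)) => [/(fsubsetP hs) ->|_]; rewrite ?orbT.
Qed.

Lemma inst_nf F w sg x s phi : w \notin F -> covers F sg (fv phi `\ x) ->
  tfv s `<=` F ->
  eqv F (MSub (fam_id F).[w <- s] (nf (w |` F) (upd sg x (Var w)) phi))
    (nf F (upd sg x s) phi).
Proof.
move=> hw c hs; have := @msub_nf (fam_id F).[w <- s] (upd sg x (Var w)) phi.
rewrite dom_setf famfv_set // famfv_id (fsetUidPr _ _ hs) => /(_ (covers_bind w c)).
congr (eqv _ _ _); apply: eq_nf => v hv /=.
case: (eqVneq v x) => [->|nvx]; first by rewrite !upd_same /= fam_sub_upd upd_same.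
rewrite !upd_neq // -[RHS]tsubst_Var; apply: eq_tsubst => u hu.
rewrite fam_sub_upd upd_neq ?fam_sub_id //.
apply: contraNneq hw => <-; apply: (fsubsetP (c v _)) => //.
by rewrite in_fsetD1 nvx.
Qed.

Lemma star_typed_inst F w s : w \notin F -> tfv s `<=` F ->
  star_typed (StarSub (fam_id F).[w <- s]) (w |` F) F.
Proof.
by move=> hw hs; split; rewrite ?dom_setf // famfv_set // famfv_id (fsetUidPr _ _ hs).
Qed.

Lemma nf_subst1 F sg x t phi :
  nf F sg (subst1 phi t x) = nf F (upd sg x (tsubst sg t)) phi.
Proof.
rewrite /subst1 nf_subst; apply: eq_nf => v _ /=.
by case: (eqVneq v x) => [->|nvx]; rewrite ?upd_same ?upd_neq.
Qed.

Lemma le_top_mvars xs S F A : lists xs S -> S `<=` F ->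
  le (F `\` S) (MTop (F `\` S)) A -> le F (MTop F) (mvars xs A).
Proof.
elim: xs S F => [|x xs IH] S F /=.
  case=> _ h _; suff -> : F `\` S = F by [].
  by apply/fsetP => v; rewrite in_fsetD -h.
case/lists_consP=> hx _ hl hS d.
have h : star_typed (StarVar L x) (F `\ x) F.
  by split=> //; apply: (fsubsetP hS).
apply: le_trans (proj2 (mstar_top h)) _; apply: (le_star h).
by apply: IH hl _ _; [apply: fsetSD | rewrite fsetDD1].
Qed.

Lemma pre_eqv_mvars xs S F X A : lists xs S -> S `<=` F ->
  pre_eqv (F `\` S) X A -> pre_eqv F (pvars xs X) (mvars xs A).
Proof.
elim: xs S F => [|x xs IH] S F /=.
  case=> _ h _; suff -> : F `\` S = F by [].
  by apply/fsetP => v; rewrite in_fsetD -h.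
case/lists_consP=> hx _ hl hS e.
have h : star_typed (StarVar L x) (F `\ x) F.
  by split=> //; apply: (fsubsetP hS).
apply: pre_eqv_trans (pre_eqv_mstar _ h); apply: (pre_eqv_star h).
by apply: IH hl _ _; [apply: fsetSD | rewrite fsetDD1].
Qed.

Lemma nf_refl F sg t : covers F sg (tfv t) -> le F (MTop F) (nf F sg (Eq t t)).
Proof.
move=> c /=; set s := tsubst sg t.
have hs : tfv s `|` tfv s `<=` F by apply: covers_eq; rewrite fsetUid.
apply: le_top_mvars (lists_enum _) (fsubsetDl _ _) _.
have -> : F `\` (F `\` (tfv s `|` tfv s)) = tfv s `|` tfv s by exact/fsetDK.
apply: (derivable_rule1 (r_eq_refl _ s _ _));
    first by rewrite /well_typed /= !eqxx.
apply: (derivable_rule1 (r_and_exch _ _ _ _));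
    first by rewrite /well_typed /= !eqxx.
apply: (derivable_rule1 (r_and_weak _ _ _ _));
    first by rewrite /well_typed /= !eqxx.
by apply/pre_eqv_eq/form_refl => /=.
Qed.

(** The rule [r_eq_subst] has no room for a hypothesis beside the equation, so [phi] at [s] is moved
    into the formula being substituted. *)
Lemma nf_leibniz F sg x s t phi :
  covers F sg (tfv s `|` tfv t `|` fv phi) ->
  le F (nf F sg (Eq s t))
    (nf F sg (Imp (subst1 phi s x) (subst1 phi t x))).
Proof.
case/coversU=> cst c; rewrite /= !nf_subst1.
set s' := tsubst sg s; set t' := tsubst sg t; set w := fresh F.
have hst : tfv s' `|` tfv t' `<=` F by apply: covers_eq.
have hs : tfv s' `<=` F by apply: fsubset_trans hst; apply: fsubsetUl.
have ht : tfv t' `<=` F by apply: fsubset_trans hst; apply: fsubsetUr.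
have hw : w \notin F := fresh_notin F.
have {}c : covers F sg (fv phi `\ x).
  by move=> v; rewrite in_fsetD1 => /andP [_ /c].
set P := nf F (upd sg x s') phi; set Q := nf (w |` F) (upd sg x (Var w)) phi.
have wP : mtyped F P by apply: mtyped_nf; apply: covers_upd.
have wQ : mtyped (w |` F) Q by apply: mtyped_nf; apply: covers_bind.
have wP' : mtyped (w |` F) (MVar w P) by rewrite /= fset1U1 fsetU1K.
(* In [M] only [Q] depends on [w]: the instance at [s'] is [P] implies [P], and the instance at [t']
   is the implication sought. *)
set M := MImp (MVar w P) Q.
have wM : mtyped (w |` F) M by rewrite /M; move: wP' => /= ->.
have inst r : tfv r `<=` F ->
    eqv F (MSub (fam_id F).[w <- r] M) (MImp P (nf F (upd sg x r) phi)).
  move=> hr; have h := star_typed_inst hw hr.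
  apply: eqv_trans (mstar_imp h wP' wQ) _.
  by apply: eqv_imp; [apply: inst_var | apply: inst_nf].
apply: le_trans (proj1 (inst _ ht)).
set xs := enum_fset (F `\` (tfv s' `|` tfv t')).
have eP : pre_eqv F (pvars xs (PEq s' t')) (pad F (tfv s' `|` tfv t') (MEq s' t')).
  apply: (pre_eqv_mvars (lists_enum _) (fsubsetDl _ _)).
  exact: pre_eqv_eq.
have hl0 r : tfv r `<=` F -> forall V, lists [::] (tfv r `\` (V `|` F)).
  move=> hr V; split=> // v; rewrite inE in_fsetD in_fsetU.
  apply/esym/negbTE; rewrite negb_and negbK.
  by case: (boolP (v \in tfv r)) => [/(fsubsetP hr) ->|_]; rewrite ?orbT.
have hsT := star_typed_inst hw hs; have htT := star_typed_inst hw ht.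
have wE : mtyped F (pad F (tfv s' `|` tfv t') (MEq s' t')).
  by apply: mtyped_pad => //=.
apply: (mstar_right htT); apply/eP.
have wpE : ptyped F (pvars xs (PEq s' t')).
  rewrite (ptyped_pvars _ _ (lists_enum _)) fsubsetDl /=; apply/eqP/esym; exact/fsetDK.
apply: (derivable_rule1 (@r_eq_subst L F t' s' (fam_id F) w xs [::] [::] M _ _ _ _)).
- by [].
- by rewrite famfv_id; apply: lists_enum.
- by rewrite famfv_id; apply: hl0.
- by rewrite famfv_id; apply: hl0.
- rewrite /well_typed [sq_pre _]/= [sq_type _]/= wpE /=.
  by have := styped_star htT M => /= ->.
apply/eP/(suc_eqv_mstar M hsT); apply: le_trans (le_top wE) _.
apply: le_trans (proj2 (inst _ hs)); apply: le_top_imp; exact: form_refl.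
Qed.

(** [V] is chosen before [F] and [sg] because the case of universal closures uses the induction
    hypothesis at an extended type and an updated substitution. *)
Lemma nf_fo_axiom phi : fo_axiom phi ->
  exists V, forall F sg, covers F sg V -> le F (MTop F) (nf F sg phi).
Proof.
elim=> {phi} [A hA|x B C|x B hx|x B t|t|x s t A|x B|x B|x A _ [V IH]].
- by exists (fv A) => F sg c; apply: nf_tautology.
- exists (fv B `|` fv C) => F sg c; rewrite /=; apply: le_top_imp.
  case/coversU: c => cB cC; set z := fresh F.
  have hz : z \notin F := fresh_notin F.
  have {}cB : covers F sg (fv B `\ x)
    by move=> v; rewrite in_fsetD1 => /andP [_ /cB].
  have {}cC : covers F sg (fv C `\ x)
    by move=> v; rewrite in_fsetD1 => /andP [_ /cC].
  have wB := mtyped_nf (covers_bind z cB); have wC := mtyped_nf (covers_bind z cC).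
  set b := nf _ _ B in wB *; set c := nf _ _ C in wC *.
  have wI : mtyped (z |` F) (MImp b c) by rewrite /= wB.
  have wAB : mtyped F (MAll z b) by rewrite /= hz.
  have wAI : mtyped F (MAll z (MImp b c)) by rewrite /= hz; rewrite /= in wI.
  apply/le_imp/all_adj => //; apply: (@le_mp _ b).
    apply: le_trans (all_elim hz wI); apply: (le_star (star_typedV hz)).
    exact: le_andr.
  apply: le_trans (all_elim hz wB); apply: (le_star (star_typedV hz)).
  exact: le_andl.
- exists (fv B) => F sg c; rewrite /=; apply: le_top_imp.
  have hz := fresh_notin F; apply/all_adj => //.
  rewrite (@eq_nf _ (upd _ _ _) sg) => [|v hv].
    by case: (mvar_nf hz c).
  by apply: upd_neq; apply: contraNneq hx => <-.
- exists (fv B `|` tfv t) => F sg /coversU [c ct]; rewrite /=; apply: le_top_imp.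
  rewrite nf_subst1; set w := fresh F; set s := tsubst sg t.
  have hw : w \notin F := fresh_notin F.
  have hs : tfv s `<=` F.
    by apply/fsubsetP => v /in_tfv_tsubst [u hu]; apply: (fsubsetP (ct u hu)).
  have {}c : covers F sg (fv B `\ x) by move=> v; rewrite in_fsetD1 => /andP [_ /c].
  have wB := mtyped_nf (covers_bind w c).
  have wA : mtyped F (MAll w (nf (w |` F) (upd sg x (Var w)) B)) by rewrite /= hw.
  (* Weakening by [w] and then instantiating it changes nothing; between the two, [all_elim] removes
     the quantifier. *)
  apply: le_trans (proj2 (inst_var hw hs wA)) _.
  apply: le_trans (proj1 (inst_nf hw c hs)).
  by apply: (le_star (star_typed_inst hw hs)); apply: all_elim.
- by exists (tfv t) => F sg c; apply: nf_refl.
- exists (tfv s `|` tfv t `|` fv A) => F sg c; apply: le_top_imp.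
  exact: nf_leibniz.
- exists (fv B) => F sg c; rewrite /=; apply: le_top_imp; set z := fresh F.
  have hz : z \notin F := fresh_notin F.
  have {}c : covers F sg (fv B `\ x) by move=> v; rewrite in_fsetD1 => /andP [_ /c].
  have wB := mtyped_nf (covers_bind z c); set b := nf _ _ B in wB *.
  have wN : mtyped (z |` F) (mneg (z |` F) b) by rewrite /= wB eqxx.
  have wA : mtyped F (MAll z (mneg (z |` F) b)) by rewrite /= hz wB eqxx.
  apply/ex_adj => //; apply: le_trans (proj2 (mvar_neg hz wA)).
  have hE := all_elim hz wN; have wE := le_typedl hE.
  apply/le_imp; apply: (@le_mp _ b); last exact: le_andr.
  by apply: le_trans hE; apply: le_andl.
- exists (fv B) => F sg c; rewrite /=; apply: le_top_imp; set z := fresh F.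
  have hz : z \notin F := fresh_notin F.
  have {}c : covers F sg (fv B `\ x) by move=> v; rewrite in_fsetD1 => /andP [_ /c].
  have wB := mtyped_nf (covers_bind z c); set b := nf _ _ B in wB *.
  have wN : mtyped (z |` F) (mneg (z |` F) b) by rewrite /= wB eqxx.
  have wA : mtyped F (MAll z (mneg (z |` F) b)) by rewrite /= hz wB eqxx.
  have wNA : mtyped F (mneg F (MAll z (mneg (z |` F) b))) by rewrite /= hz wB !eqxx.
  have wE : mtyped F (MEx z b) by rewrite /= hz.
  have wNE : mtyped F (mneg F (MEx z b)) by rewrite /= hz wB eqxx.
  (* If the existential formula fails, every instance of the body fails, against the hypothesis. *)
  apply: (le_case wE); first exact: le_andl.
  apply: le_trans (le_bot wE); apply: (@le_mp _ (MAll z (mneg (z |` F) b))).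
    exact: le_andr.
  apply: (le_trans (le_andl wNE wNA)); apply/all_adj => //.
  apply: le_trans (proj1 (mvar_neg hz wE)) _; apply: le_imp2.
    exact: ex_intro.
  by apply: form_refl => /=.
- exists V => F sg c /=; set z := fresh F; have hz : z \notin F := fresh_notin F.
  apply/all_adj => //; apply: le_trans (proj1 (mstar_top (star_typedV hz))) _.
  apply: IH; apply: covers_bind => v; rewrite in_fsetD1 => /andP [_]; exact: c.
Qed.

(** * From Hilbert proofs back to the original type *)

Lemma nf_fo_provable phi : fo_provable phi ->
  exists V, forall F sg, covers F sg V -> le F (MTop F) (nf F sg phi).
Proof.
elim=> {phi} [A /nf_fo_axiom //|A B _ [V hV] _ [W hW]|A B hAB _ [V hV]].
  by exists (V `|` W) => F sg /coversU [/hV h /hW]; apply: le_mp.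
by exists V => F sg /hV; rewrite (nf_alpha _ _ hAB).
Qed.

(* Reflecting derivability along weakening of types is where the
   non-emptiness of the domain enters. *)
Lemma nf_shrink F xs sg phi : covers F sg (fv phi) ->
  let G := foldr (fun x S => x |` S) F xs in
  le G (MTop G) (nf G sg phi) -> le F (MTop F) (nf F sg phi).
Proof.
move=> c; elim: xs => //= x xs; set G := foldr _ F xs => IH.
case: (boolP (x \in G)) => [hx|hx d]; first by rewrite mem_fset1U.
apply: IH; have cG : covers G sg (fv phi).
  apply: covers_sub c; rewrite /G; elim: (xs) => //= y ys h.
  exact: fsubset_trans h (fsubsetU1 _ _).
apply: (le_var_reflect hx); apply: le_trans (proj1 (mstar_top (star_typedV hx))) _.
by apply: (le_trans d); case: (mvar_nf hx cG).
Qed.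

End Completeness.

Theorem theorem13 (L : language) (F : {fset nat}) (A : mform L) :
  mtyped F A -> fo_provable (tau A) -> derivable (PTop F |-[F] A).
Proof.
move=> wA /nf_fo_provable [V hV]; apply/derivable_top.
apply: le_trans (proj2 (eqv_nf wA)).
(* [hV] covers only types that contain [V], so [F] is enlarged by [V] and the result is shrunk
   back. *)
apply: (@nf_shrink _ F (enum_fset V)); first by apply/covers_VarE; apply: fv_tau.
set G := foldr _ _ _; apply: hV; apply/covers_VarE/fsubsetP => v hv.
rewrite /G; have: v \in enum_fset V by [].
elim: (enum_fset V) => //= x xs IH; rewrite inE in_fset1U.
by case/orP=> [->//|/IH ->]; rewrite orbT.
Qed.
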